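(* For every $n\ge 1$ let $S(n)$ denote the minimum size of a P-encoding with $n$ input variables and let $S_2(n)$ denote the minimum size of a P-encoding with $n$ input variables which is a 2-CNF formula. Then every propagation complete encoding of $\mathrm{AMO}_n$ or of $\mathrm{EO}_n$ has size at least $S(n)$; the smallest size of a 2-CNF encoding (not required to be propagation complete) of $\mathrm{AMO}_n$ equals $S_2(n)$; and moreover: (1) for $3\le n\le 8$ we have $S(n)=S_2(n)=3n-6$; (2) for $n\ge 9$ we have $S(n)\ge 2n+\sqrt{n}-2$; (3) for $n\ge 9$ we have $S_2(n)\ge 2n+2\sqrt{n}-3$.
   Context: A literal is a boolean variable $x$ or its negation $\neg x$. A clause is a disjunction of a finite set of literals containing no complementary pair; a CNF formula is a conjunction of a finite set of clauses, and its size $|\varphi|$ is its number of clauses. A 2-CNF formula is a CNF formula all of whose clauses have at most two literals. Two clauses $C_1,C_2$ are resolvable if there is exactly one literal $l$ with $l\in C_1$, $\neg l\in C_2$; their resolvent is $(C_1\cup C_2)\setminus\{l,\neg l\}$; it is a unit resolution step if $C_1$ or $C_2$ is a single literal. For literals $g_1,\dots,g_p$ we write $\varphi\wedge g_1\wedge\dots\wedge g_p\vdash_1 C$ if the clause $C$ can be derived from the clauses of $\varphi$ together with the unit clauses $g_1,\dots,g_p$ by a sequence of unit resolution steps (or is among them), and $\vdash_1\bot$ if the empty clause can be so derived. $\mathrm{AMO}_n(x_1,\dots,x_n)$ is the boolean function that is $1$ iff at most one $x_i$ is $1$; $\mathrm{EO}_n(x_1,\dots,x_n)$ is $1$ iff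 exactly one $x_i$ is $1$. A CNF formula $\varphi(\mathbf{x},\mathbf{y})$ with input variables $\mathbf{x}=(x_1,\dots,x_n)$ and auxiliary variables $\mathbf{y}=(y_1,\dots,y_\ell)$ is an encoding of a boolean function $f(\mathbf{x})$ if for every $\alpha\in\{0,1\}^n$: $f(\alpha)=1$ iff there is $\beta\in\{0,1\}^\ell$ with $\varphi(\alpha,\beta)=1$. It is a propagation complete (PC) encoding of $f$ if it is an encoding of $f$ and for all literals $g_1,\dots,g_p$ ($p\ge1$) and $h$ on input variables with $f(\mathbf{x})\wedge\bigwedge_i g_i\models h$, we have $\varphi\wedge\bigwedge_i g_i\vdash_1 h$ or $\varphi\wedge\bigwedge_i g_i\vdash_1\bot$. A formula $\varphi(\mathbf{x},\mathbf{y})$ with $n\ge1$ input variables $x_1,\dots,x_n$ and $\ell\ge 0$ auxiliary variables is a P-encoding if (P1) $\varphi\wedge x_i$ is satisfiable for each $i$, and (P2) $\varphi\wedge x_i\vdash_1\neg x_j$ for all $i\neq j$. *)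

(* Defs.v *)
From mathcomp Require Import all_boot all_order all_algebra.

Set Implicit Arguments.
Unset Strict Implicit.
Unset Printing Implicit Defensive.

Section CNF.
Variable V : finType.

(* (x, true) is the literal x and (x, false) is its negation. *)
Definition lit : finType := (V * bool)%type.

Definition pos (x : V) : lit := (x, true).
Definition neg (x : V) : lit := (x, false).
Definition compl (l : lit) : lit := (l.1, ~~ l.2).

(* A clause is a set of literals satisfying is_clause, a CNF formula is a set
   of such sets satisfying is_cnf; the size of phi is #|phi|. *)
Definition is_clause (C : {set lit}) : bool :=
  [forall l in C, compl l \notin C].

Definition is_cnf (phi : {set {set lit}}) : bool :=
  [forall C in phi, is_clause C].

Definition is_2cnf (phi : {set {set lit}}) : bool :=
  is_cnf phi && [forall C in phi, #|C| <= 2].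

Definition eval_lit (a : {ffun V -> bool}) (l : lit) : bool := a l.1 == l.2.

Definition eval_clause (a : {ffun V -> bool}) (C : {set lit}) : bool :=
  [exists l in C, eval_lit a l].

Definition eval_cnf (a : {ffun V -> bool}) (phi : {set {set lit}}) : bool :=
  [forall C in phi, eval_clause a C].

Definition satisfiable (phi : {set {set lit}}) : Prop :=
  exists a : {ffun V -> bool}, eval_cnf a phi.

(* phi /\ g_1 /\ ... /\ g_p *)
Definition assume (phi : {set {set lit}}) (gs : seq lit) : {set {set lit}} :=
  phi :|: [set [set g] | g in gs].

(* C1 and C2 are resolvable, and l is the only literal with l in C1 and
   compl l in C2. *)
Definition resolvable_on (l : lit) (C1 C2 : {set lit}) : Prop :=
  [set k in C1 | compl k \in C2] = [set l].

Definition resolvent (l : lit) (C1 C2 : {set lit}) : {set lit} :=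
  (C1 :|: C2) :\: [set l; compl l].

Inductive unit_derives (phi : {set {set lit}}) : {set lit} -> Prop :=
| UnitDerivesIn C : C \in phi -> unit_derives phi C
| UnitDerivesRes C1 C2 l :
    unit_derives phi C1 -> unit_derives phi C2 ->
    resolvable_on l C1 C2 -> (#|C1| == 1) || (#|C2| == 1) ->
    unit_derives phi (resolvent l C1 C2).

End CNF.

Definition boolfun (n : nat) := {ffun 'I_n -> bool} -> bool.

Definition AMO (n : nat) : boolfun n := fun a => #|[set i | a i]| <= 1.
Definition EO (n : nat) : boolfun n := fun a => #|[set i | a i]| == 1.

(* Formulas phi(x, y) with n input and l auxiliary variables are over the
   variable type 'I_n + 'I_l: inl i is x_i and inr j is y_j. *)
Section Encodings.
Variables n l : nat.
Implicit Type phi : {set {set lit ('I_n + 'I_l)%type}}.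

Definition join (a : {ffun 'I_n -> bool}) (b : {ffun 'I_l -> bool}) :
    {ffun 'I_n + 'I_l -> bool} :=
  [ffun v => match v with inl i => a i | inr j => b j end].

Definition input_lit (g : lit 'I_n) : lit ('I_n + 'I_l)%type := (inl g.1, g.2).

Definition encoding (f : boolfun n) phi : Prop :=
  is_cnf phi /\
  forall a : {ffun 'I_n -> bool},
    f a <-> exists b : {ffun 'I_l -> bool}, eval_cnf (join a b) phi.

(* f(x) /\ g_1 /\ ... /\ g_p |= h *)
Definition entails (f : boolfun n) (gs : seq (lit 'I_n)) (h : lit 'I_n) : Prop :=
  forall a : {ffun 'I_n -> bool}, f a -> all (eval_lit a) gs -> eval_lit a h.

Definition PC_encoding (f : boolfun n) phi : Prop :=
  encoding f phi /\
  forall (gs : seq (lit 'I_n)) (h : lit 'I_n),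
    0 < size gs -> entails f gs h ->
    unit_derives (assume phi (map input_lit gs)) [set input_lit h] \/
    unit_derives (assume phi (map input_lit gs)) set0.

Definition P_encoding phi : Prop :=
  [/\ 0 < n,
      is_cnf phi,
      forall i : 'I_n, satisfiable (assume phi [:: input_lit (pos i)])
    & forall i j : 'I_n, i != j ->
        unit_derives (assume phi [:: input_lit (pos i)]) [set input_lit (neg j)]].

End Encodings.

Definition P_encoding_size (n m : nat) : Prop :=
  exists (l : nat) (phi : {set {set lit ('I_n + 'I_l)%type}}),
    P_encoding phi /\ #|phi| = m.

Definition P_encoding_2cnf_size (n m : nat) : Prop :=
  exists (l : nat) (phi : {set {set lit ('I_n + 'I_l)%type}}),
    [/\ P_encoding phi, is_2cnf phi & #|phi| = m].

Definition encoding_2cnf_size (n : nat) (f : boolfun n) (m : nat) : Prop :=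
  exists (l : nat) (phi : {set {set lit ('I_n + 'I_l)%type}}),
    [/\ encoding f phi, is_2cnf phi & #|phi| = m].

Definition minimum (A : nat -> Prop) (m : nat) : Prop :=
  A m /\ forall k, A k -> m <= k.

(* Main.v *)
Require Import Defs.
From mathcomp Require Import all_boot all_order all_algebra.
From mathcomp Require Import boolp zify lra.
Import Order.TTheory GRing.Theory Num.Theory.

(**
  Inputs are treated as a set X of literals, so that they may be any literals of
  the formula. Setting literals to constants and identifying literals both map
  P-encodings to P-encodings.

  Let phi be a minimal P-encoding with n inputs. If ~x \/ y is a clause and y
  alone propagates to the negation of every other input, identifying y with x
  saves a clause. Hence every input x occurs negatively at least twice, and if
  exactly twice, in two binary clauses. If some input has three negative
  occurrences, or shares a clause ~x \/ ~h with another input, then removing it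
  saves three clauses and one proceeds by induction on n. Otherwise phi is
  regular: each x has exactly two clauses x -> y, x -> z with y, z auxiliary;
  besides these 2n clauses there is a set of remaining clauses.

  If d inputs imply the same literal y, keep only those and set y to true: all of
  them are left with one negative occurrence, whence |phi| >= 2n + 2d - 3.
  If no literal is implied by more than D inputs, follow the propagation from
  each input to the first remaining clause that fires; the same clause is met by
  at most 2D inputs, so there are at least n / 2D remaining clauses.

  For 2-CNF, take y that is directly implied by d inputs and by no other such
  literal. Removing its d inputs and setting y to false saves 2d + 2 clauses.
*)

Set Implicit Arguments.
Unset Strict Implicit.
Unset Printing Implicit Defensive.


(** * Unit propagation, P-encodings on sets of literals, restriction and substitution *)

Section Propagation.
Variable V : finType.
Implicit Types (phi psi : {set {set lit V}}) (C D T X : {set lit V}).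
Implicit Types (g h k l u v x y z : lit V) (a b : {ffun V -> bool}).

Lemma complK : involutive (@compl V).
Proof. by case=> v b; rewrite /compl /= negbK. Qed.

Lemma compl_inj : injective (@compl V).
Proof. exact: inv_inj complK. Qed.

Lemma compl_neq l : compl l != l.
Proof. by case: l => v []; rewrite /compl /= xpair_eqE andbF. Qed.

Lemma eval_compl a l : eval_lit a (compl l) = ~~ eval_lit a l.
Proof. by case: l => v b; rewrite /eval_lit /=; case: (a v); case: b. Qed.

Lemma eval_clauseP a C :
  reflect (exists2 l, l \in C & eval_lit a l) (eval_clause a C).
Proof. exact: exists_inP. Qed.

Lemma eval_cnfP a phi :
  reflect (forall C, C \in phi -> exists2 l, l \in C & eval_lit a l)
          (eval_cnf a phi).
Proof.
apply: (iffP forall_inP) => H C /H; [by move/eval_clauseP | by move/eval_clauseP].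
Qed.

Lemma is_clauseP C :
  reflect (forall l, l \in C -> compl l \notin C) (is_clause C).
Proof. exact: forall_inP. Qed.

Lemma is_clauseS C D : C \subset D -> is_clause D -> is_clause C.
Proof.
move=> sCD /is_clauseP H; apply/is_clauseP => l /(subsetP sCD)/H.
by apply: contra; apply: (subsetP sCD).
Qed.

(** Unit resolution reduced to literals, with no intermediate clauses. [unit_derives_up] relates it
    to [unit_derives]. *)
Inductive up phi g : lit V -> Prop :=
| up_start : up phi g g
| up_step C l : C \in phi -> l \in C ->
    (forall k, k \in C -> k != l -> up phi g (compl k)) -> up phi g l.

Lemma up_sound a phi g l :
  eval_cnf a phi -> eval_lit a g -> up phi g l -> eval_lit a l.
Proof.
move=> /eval_cnfP Ha Hg; elim=> {l}// C l /Ha [k kC ek] _ _ IH.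
have [<-//|kl] := eqVneq k l.
by have := IH k kC kl; rewrite eval_compl ek.
Qed.

Lemma up_gt0 phi g l : up phi g l -> l != g -> 0 < #|phi|.
Proof.
by case=> [|C m CP _ _ _]; [rewrite eqxx | apply/card_gt0P; exists C].
Qed.

Lemma up_trans phi g l k : up phi g l -> up phi l k -> up phi g k.
Proof. by move=> H; elim=> // C m CP mC _ IH; apply: up_step CP mC IH. Qed.

Lemma up_bin phi g u v : [set compl u; v] \in phi -> up phi g u -> up phi g v.
Proof.
move=> CP Hu; apply: up_step CP _ _; first by rewrite !inE eqxx orbT.
by move=> k; rewrite !inE => /orP[] /eqP-> //; rewrite ?complK // eqxx.
Qed.

(** Descend the derivation of [l] through premises outside [T]; since [g] lies in [T], the descent
    stops at a clause all of whose premises are in [T]. *)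
Lemma first_firing phi g l T :
  up phi g l -> g \in T -> l \notin T ->
  exists C w, [/\ C \in phi, w \in C, w \notin T
    & forall k, k \in C -> k != w -> compl k \in T].
Proof.
move=> H gT; elim: H => [|C m CP mC _ IH]; first by rewrite gT.
move=> mT; have [/forall_inP H|] := boolP [forall k in C, (k != m) ==> (compl k \in T)].
  by exists C, m; split=> // k kC km; have := H k kC; rewrite km.
by case/forall_inPn=> k kC; rewrite negb_imply => /andP[km] /(IH k kC km).
Qed.

(** If the subclause [D] misses [l], propagation refutes all of [D], which the model [a] forbids. *)
Lemma up_subsume a phi psi g l :
    (forall C, C \in phi -> exists2 D, D \in psi & D \subset C) ->
    eval_cnf a psi -> eval_lit a g ->
  up phi g l -> up psi g l.
Proof.
move=> sub Ha Hg; elim=> {l}[|C l CP lC _ IH]; first exact: up_start.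
have [D DP sDC] := sub C CP.
have [lD|lD] := boolP (l \in D).
  by apply: up_step DP lD _ => k kD; apply: IH; apply: (subsetP sDC).
have /eval_cnfP/(_ D DP)[k kD ek] := Ha.
have kl : k != l by apply: contraNneq lD => <-.
have := up_sound Ha Hg (IH k (subsetP sDC _ kD) kl).
by rewrite eval_compl ek.
Qed.

(** The width bound [w] lets one development serve arbitrary formulas and, for [w = 2], 2-CNF
    formulas. *)
Record Penc (w : nat) phi X : Prop := MkPenc {
  Penc_cnf : is_cnf phi;
  Penc_width : forall C, C \in phi -> #|C| <= w;
  Penc_model : forall g, g \in X -> exists2 a, eval_cnf a phi & eval_lit a g;
  Penc_up : forall g h, g \in X -> h \in X -> g != h -> up phi g (compl h) }.

Lemma Penc_clause w phi X C : Penc w phi X -> C \in phi -> is_clause C.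
Proof. by move=> [/forall_inP H _ _ _] /H. Qed.

Lemma Penc_false w phi X a g h : Penc w phi X -> g \in X -> h \in X -> g != h ->
  eval_cnf a phi -> eval_lit a g -> ~~ eval_lit a h.
Proof.
by move=> P gX hX gh Ha Hg; rewrite -eval_compl; apply: up_sound Ha Hg (Penc_up P gX hX gh).
Qed.

Lemma exists_third X g h : 2 < #|X| -> exists k, [/\ k \in X, k != g & k != h].
Proof.
move=> X3; suff: 0 < #|X :\: [set g; h]|.
  by case/card_gt0P=> k; rewrite !inE negb_or => /andP[/andP[? ?] ?]; exists k.
rewrite cardsD subn_gt0; apply: leq_ltn_trans (subset_leq_card (subsetIr _ _)) _.
by apply: leq_ltn_trans X3; rewrite cards2; case: (g != h).
Qed.

(** A third input would refute both [g] and [compl g]. *)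
Lemma Penc_compl w phi X g : Penc w phi X -> 2 < #|X| -> g \in X -> compl g \notin X.
Proof.
move=> P X3 gX; apply/negP => cX.
have [k [kX kg kc]] := exists_third g (compl g) X3.
have [a Ha Hk] := Penc_model P kX.
have := Penc_false P kX cX kc Ha Hk.
by rewrite eval_compl (negPf (Penc_false P kX gX kg Ha Hk)).
Qed.

(** The restriction of [phi] by the partial assignment that makes the literals of [T] true. *)
Definition red phi T : {set {set lit V}} :=
  [set C :\: [set k | compl k \in T] | C in [set C in phi | [disjoint C & T]]].

Lemma redP phi T D :
  reflect (exists C, [/\ C \in phi, [disjoint C & T] & D = C :\: [set k | compl k \in T]])
          (D \in red phi T).
Proof.
apply: (iffP imsetP) => [[C]|[C [CP dC ->]]].
  by rewrite inE => /andP[? ?] ->; exists C.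
by exists C; rewrite // inE CP.
Qed.

(** Whatever [g] propagates in [phi] is in [T] or is propagated in the restriction. The first is
    impossible for the negation of an input [h], as some model of [h] satisfies [T]. *)
Lemma red_Penc w phi X X' T : Penc w phi X -> X' \subset X ->
    (forall g, g \in X' -> exists a,
       [/\ eval_cnf a phi, eval_lit a g & forall t, t \in T -> eval_lit a t]) ->
  Penc w (red phi T) X'.
Proof.
move=> P sX HT.
have Hm a : eval_cnf a phi -> (forall t, t \in T -> eval_lit a t) -> eval_cnf a (red phi T).
  move=> /eval_cnfP Ha Ht; apply/eval_cnfP => D /redP[C [/Ha[l lC el] dC ->]].
  exists l; rewrite // !inE lC andbT; apply/negP => /Ht.
  by rewrite eval_compl el.
split.
- apply/forall_inP => D /redP[C [CP _ ->]].
  exact: is_clauseS (subsetDl _ _) (Penc_clause P CP).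
- move=> D /redP[C [CP _ ->]]; apply: leq_trans (Penc_width P CP).
  exact: subset_leq_card (subsetDl _ _).
- by move=> g /HT[a [? ? ?]]; exists a => //; apply: Hm.
move=> g h gX hX gh.
have [a [Ha Hg Ht]] := HT g gX.
have Hr := Hm a Ha Ht.
have H l : up phi g l -> l \in T \/ up (red phi T) g l.
  elim=> {l}[|C l CP lC _ IH]; first by right; apply: up_start.
  have [?|lT] := boolP (l \in T); [by left|right].
  have [dC|] := boolP [disjoint C & T]; last first.
    case/pred0Pn => k /andP[/= kC kT].
    have kl : k != l by apply: contraNneq lT => <-.
    case: (IH k kC kl) => [/Ht|/(up_sound Hr Hg)]; by rewrite eval_compl (Ht k kT).
  apply: (@up_step _ _ (C :\: [set k | compl k \in T])).
  - by apply/redP; exists C.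
  - rewrite !inE lC andbT; apply/negP => clT.
    have /eval_cnfP/(_ C CP)[k kC ek] := Ha.
    have [kl|kl] := eqVneq k l; first by have := Ht _ clT; rewrite eval_compl -kl ek.
    case: (IH k kC kl) => [/Ht|/(up_sound Hr Hg)]; by rewrite eval_compl ek.
  - by move=> k; rewrite !inE => /andP[/negPf kT kC] kl; case: (IH k kC kl); rewrite ?kT.
case: (H _ (Penc_up P (subsetP sX _ gX) (subsetP sX _ hX) gh)) => // hT.
have [b [_ Hh /(_ _ hT)]] := HT h hX.
by rewrite eval_compl Hh.
Qed.

Lemma card_red phi T (Q : {set {set lit V}}) :
  Q \subset phi -> (forall C, C \in Q -> ~~ [disjoint C & T]) ->
  #|red phi T| + #|Q| <= #|phi|.
Proof.
move=> sQ HQ; apply: (@leq_trans (#|[set C in phi | [disjoint C & T]]| + #|Q|)).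
  by rewrite leq_add2r; apply: leq_imset_card.
rewrite -(cardsID Q phi) (setIidPr sQ) addnC leq_add2l.
apply: subset_leq_card; apply/subsetP => C; rewrite !inE => /andP[-> dC].
by rewrite andbT; apply: contraL dC => /HQ.
Qed.

Definition occ phi l : {set {set lit V}} := [set C in phi | l \in C].

Lemma occ_red phi T l :
  #|occ (red phi T) l| <= #|[set C in occ phi l | [disjoint C & T]]|.
Proof.
apply: leq_trans (leq_imset_card (fun C => C :\: [set k | compl k \in T]) _).
apply: subset_leq_card; apply/subsetP => D; rewrite inE => /andP[/redP[C [CP dC ->]]].
rewrite inE => /andP[_ lC]; apply/imsetP; exists C => //.
by rewrite !inE CP lC.
Qed.

Lemma occ_red_le phi T l : #|occ (red phi T) l| <= #|occ phi l|.
Proof.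
apply: leq_trans (occ_red _ _ _) _; apply: subset_leq_card.
by apply/subsetP => C; rewrite inE => /andP[].
Qed.

(** Images with a complementary pair are tautologies; dropping them is how identifying literals
    saves clauses. *)
Definition sub (s : lit V -> lit V) phi : {set {set lit V}} :=
  [set C in [set s @: C | C : {set lit V} in phi] | is_clause C].

(** The models respecting [s] keep the images of the inputs distinct and satisfiable; propagation is
    carried over clause by clause. *)
Lemma sub_Penc w s phi X : Penc w phi X ->
    (forall l, s (compl l) = compl (s l)) ->
    (forall g, g \in X -> exists a,
       [/\ eval_cnf a phi, eval_lit a g & forall l, eval_lit a (s l) = eval_lit a l]) ->
  Penc w (sub s phi) (s @: X) /\ #|s @: X| = #|X|.
Proof.
move=> P sC HX.
have Hm a : eval_cnf a phi -> (forall l, eval_lit a (s l) = eval_lit a l) ->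
    eval_cnf a (sub s phi).
  move=> /eval_cnfP Ha Hs; apply/eval_cnfP => D; rewrite inE => /andP[/imsetP[C /Ha[l lC el] ->] _].
  by exists (s l); rewrite ?imset_f ?Hs.
split; last first.
  apply: card_in_imset => g h gX hX sgh; apply/eqP; apply: contraT => gh.
  have [a [Ha Hg Hs]] := HX g gX.
  by have := Penc_false P gX hX gh Ha Hg; rewrite -(Hs h) -sgh Hs Hg.
split.
- by apply/forall_inP => D; rewrite inE => /andP[].
- move=> D; rewrite inE => /andP[/imsetP[C CP ->] _].
  by apply: leq_trans (leq_imset_card _ _) (Penc_width P CP).
- move=> _ /imsetP[g gX ->]; have [a [Ha Hg Hs]] := HX g gX.
  by exists a; [apply: Hm | rewrite Hs].
move=> _ _ /imsetP[g gX ->] /imsetP[h hX ->] sgh; rewrite -sC.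
have [a [Ha Hg Hs]] := HX g gX; have Hr := Hm a Ha Hs.
have gh : g != h by apply: contraNneq sgh => ->.
have Hsg : eval_lit a (s g) by rewrite Hs.
elim: (Penc_up P gX hX gh) => [|C l CP lC _ IH]; first exact: up_start.
have [cC|] := boolP (is_clause (s @: C)).
  apply: (@up_step _ _ (s @: C)); first by rewrite inE cC imset_f.
    exact: imset_f.
  move=> _ /imsetP[k kC ->] skl; rewrite -sC; apply: IH kC _.
  by apply: contraNneq skl => ->.
(* The image clause is a tautology. If one literal of its complementary pair comes from [l], the
   premise for the other already yields [s l]; otherwise two premises have opposite images, against
   the model. *)
case/forall_inPn => _ /imsetP[k1 k1C ->]; rewrite negbK => /imsetP[k2 k2C k12].
have [k1l|k1l] := eqVneq k1 l.
  rewrite -k1l -[s k1]complK k12 -sC; apply: IH => //.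
  by apply: contraNneq (compl_neq (s l)) => k2l; rewrite -{1}k1l k12 k2l.
have [k2l|k2l] := eqVneq k2 l.
  by rewrite -k2l -k12 -sC; apply: IH.
have := up_sound Hr Hsg (IH k1 k1C k1l); have := up_sound Hr Hsg (IH k2 k2C k2l).
by rewrite !sC -k12 !eval_compl => /negbTE ->.
Qed.

Lemma card_sub s phi C : C \in phi -> ~~ is_clause (s @: C) -> #|sub s phi| < #|phi|.
Proof.
move=> CP nC; rewrite (cardsD1 C phi) CP add1n ltnS.
apply: leq_trans (leq_imset_card (fun C => s @: C) _).
apply: subset_leq_card; apply/subsetP => D; rewrite inE => /andP[/imsetP[E EP ->] cE].
apply/imsetP; exists E => //; rewrite !inE EP andbT.
by apply: contraNneq nC => <-.
Qed.

Definition sbst u v l := if l == u then v else if l == compl u then compl v else l.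

Lemma sbstC u v l : sbst u v (compl l) = compl (sbst u v l).
Proof.
rewrite /sbst (inj_eq compl_inj) (can2_eq complK complK).
by have [->|_] := eqVneq l u; rewrite ?[u == _]eq_sym ?(negPf (compl_neq u)) //;
  case: ifP => // _; rewrite complK.
Qed.

Lemma sbst_u u v : sbst u v u = v. Proof. by rewrite /sbst eqxx. Qed.
Lemma eval_sbst a u v l : eval_lit a u = eval_lit a v ->
  eval_lit a (sbst u v l) = eval_lit a l.
Proof.
rewrite /sbst => auv; case: eqP => [->//|_]; case: eqP => [->|//].
by rewrite !eval_compl auv.
Qed.

(* Replacing v by u when the clause "u implies v" is present and every model can
   be chosen with u = v: that clause becomes a tautology. *)
Lemma merge_Penc w phi X u v : Penc w phi X -> [set compl u; v] \in phi -> v != compl u ->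
    (forall g, g \in X -> exists a,
       [/\ eval_cnf a phi, eval_lit a g & eval_lit a v = eval_lit a u]) ->
  [/\ Penc w (sub (sbst v u) phi) (sbst v u @: X), #|sbst v u @: X| = #|X|
    & #|sub (sbst v u) phi| < #|phi|].
Proof.
move=> P CP vu HX.
have vu' : v != u.
  have /is_clauseP/(_ v) := Penc_clause P CP.
  by rewrite !inE eqxx orbT => /(_ isT); apply: contraNneq => ->; rewrite eqxx.
have [|] := @sub_Penc w (sbst v u) _ _ P (sbstC v u).
  move=> g /HX[a [Ha Hg E]]; exists a; split=> // l; exact: eval_sbst.
move=> P' cX; split=> //; apply: card_sub CP _.
apply/is_clauseP => /(_ u); rewrite !imsetU !imset_set1 sbst_u !inE eqxx orbT => /(_ isT).
case/norP => /eqP []; rewrite /sbst (negPf (_ : compl u != v)); last by rewrite eq_sym.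
by rewrite (inj_eq compl_inj) eq_sym (negPf vu').
Qed.

End Propagation.


(** * Inputs with at most one negative occurrence; formulas of minimal cost *)

Section Thin.
Variables (V : finType) (w : nat).
Implicit Types (phi psi : {set {set lit V}}) (C D T X : {set lit V}).
Implicit Types (g h k l u v x y z : lit V) (a b : {ffun V -> bool}).

Lemma unit_red phi X l : Penc w phi X -> [set l] \in phi ->
  Penc w (red phi [set l]) X /\ #|red phi [set l]| < #|phi|.
Proof.
move=> P lP; split.
  apply: (red_Penc P (subxx _)) => g gX; have [a Ha Hg] := Penc_model P gX.
  exists a; split=> // t /set1P->.
  by have /eval_cnfP/(_ _ lP)[k /set1P->] := Ha.
have := @card_red _ phi [set l] [set [set l]]; rewrite cards1 addn1; apply.
  by rewrite sub1set.
by move=> C /set1P->; rewrite disjoints1 set11.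
Qed.

Lemma Penc_pair_compl phi X x y : Penc w phi X -> [set compl x; y] \in phi -> y != x.
Proof.
move=> P CP; have /is_clauseP/(_ y) := Penc_clause P CP.
by rewrite !inE eqxx orbT => /(_ isT); apply: contraNneq => ->; rewrite eqxx.
Qed.

Lemma eval_pair phi a x y : eval_cnf a phi -> [set compl x; y] \in phi ->
  eval_lit a x -> eval_lit a y.
Proof.
move=> Ha CP Hx; apply: up_sound Ha Hx _; apply: up_bin CP _; exact: up_start.
Qed.

Lemma binary_clause phi X x : Penc w phi X -> 2 < #|X| -> x \in X ->
    (forall l, [set l] \notin phi) ->
  exists2 y, [set compl x; y] \in phi & y != compl x.
Proof.
move=> P X3 xX nu; have [h [hX hx _]] := exists_third x x X3.
have hx' : compl h \notin [set x].
  by rewrite inE; apply: contraTneq xX => <-; apply: Penc_compl P X3 hX.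
have xh : x != h by rewrite eq_sym.
have [C [l [CP lC _ HC]]] := first_firing (Penc_up P xX hX xh) (set11 x) hx'.
have sC k : k \in C -> k != l -> k = compl x.
  by move=> kC /(HC k kC)/set1P <-; rewrite complK.
have [k /andP[kC kl]|nk] := pickP [pred k | (k \in C) && (k != l)].
  exists l; last by rewrite eq_sym -(sC k kC kl).
  suff -> : [set compl x; l] = C by [].
  apply/setP => m; rewrite !inE; apply/orP/idP => [[]/eqP->//|mC].
    by rewrite -(sC k).
  by have [?|/(sC m mC) ->] := eqVneq m l; [right | left].
case/negP: (nu l); suff <- : C = [set l] by [].
apply/setP => m; rewrite inE; apply/idP/eqP => [mC|->//].
by apply/eqP; apply: contraFT (nk m) => ml; rewrite /= mC ml.
Qed.

(** If no other clause containing [compl x] ever fires, the only use of [x] in the propagation is to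
    obtain [y]. *)
Lemma up_via phi X x y h : Penc w phi X -> 2 < #|X| -> x \in X ->
    [set compl x; y] \in phi ->
    (forall C z, C \in phi -> compl x \in C -> C != [set compl x; y] ->
       z \in C -> z != compl x ->
       ~ (forall k, k \in C -> k != z -> up phi x (compl k))) ->
    h \in X -> h != x -> up phi y (compl h).
Proof.
move=> P X3 xX CP nf hX hx.
have [a Ha Hx] := Penc_model P xX.
suff H l : up phi x l -> l = x \/ up phi y l.
  have xh : x != h by rewrite eq_sym.
  case: (H _ (Penc_up P xX hX xh)) => // E.
  by have := Penc_compl P X3 hX; rewrite E xX.
elim=> {l}[|C l CC lC HC IH]; first by left.
right; have Hl : up phi x l by apply: up_step CC lC HC.
have lx : l != compl x.
  by apply/negP => /eqP E; have := up_sound Ha Hx Hl; rewrite E eval_compl Hx.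
have [xC|xC] := boolP (compl x \in C).
  have [E|nE] := eqVneq C [set compl x; y].
    by move: lC; rewrite E !inE (negPf lx) => /eqP ->; apply: up_start.
  by case: (nf C l CC xC nE lC lx).
apply: up_step CC lC _ => k kC kl; case: (IH k kC kl) => // E.
by case/negP: xC; rewrite -E complK.
Qed.

(* If y alone already excludes all the other inputs, the input x can take over
   the role of y. *)
Lemma merge_input phi X x y : Penc w phi X -> 2 < #|X| -> x \in X ->
    [set compl x; y] \in phi -> y != compl x ->
    (forall h, h \in X -> h != x -> up phi y (compl h)) ->
  exists phi', [/\ Penc w phi' X, #|phi'| < #|phi|
    & forall h, h \in X -> h != x -> #|occ phi' (compl h)| <= #|occ phi (compl h)|].
Proof.
move=> P X3 xX CP yx Hy.
have [|P' _ lt'] := merge_Penc P CP yx.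
  move=> g gX; have [a Ha Hg] := Penc_model P gX; exists a; split=> //.
  have [gx|gx] := eqVneq g x; first by rewrite -gx Hg (eval_pair Ha CP) // -gx.
  (* A model of another input [g] falsifies [x], and also [y], because [y] propagates [compl g]. *)
  rewrite (negPf (Penc_false P gX xX gx Ha Hg)).
  apply: contraTF Hg => Hy'; rewrite -eval_compl; exact: up_sound Ha Hy' (Hy g gX gx).
set s := sbst y x in P' lt'.
have [a Ha Hx] := Penc_model P xX; have Hya := eval_pair Ha CP Hx.
have yX : y \notin X.
  apply/negP => yX; have xy : x != y by rewrite eq_sym (Penc_pair_compl P CP).
  by have := Penc_false P xX yX xy Ha Hx; rewrite Hya.
have cyX : compl y \notin X.
  apply/negP => cyX; have [k [kX kx ky]] := exists_third x (compl y) X3.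
  have [b Hb Hk] := Penc_model P kX.
  have := up_sound Hb Hk (up_trans (Penc_up P kX cyX ky) _); rewrite complK.
  by move=> /(_ _ (Hy k kX kx)); rewrite eval_compl Hk.
have sX h : h \in X -> s h = h.
  move=> hX; rewrite /s /sbst; case: eqP => [E|_]; first by rewrite -E hX in yX.
  by case: eqP => // E; rewrite -E hX in cyX.
have sE : s @: X = X.
  apply/setP => h; apply/imsetP/idP => [[k kX ->]|hX]; first by rewrite sX.
  by exists h; rewrite ?sX.
exists (sub s phi); rewrite -{1}sE; split=> // h hX hx.
apply: leq_trans (leq_imset_card (fun C => s @: C) _).
apply: subset_leq_card; apply/subsetP => D; rewrite !inE.
case/andP=> /andP[/imsetP[C CP' ->] _] /imsetP[m mC E].
apply/imsetP; exists C; rewrite // inE CP'.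
suff -> : compl h = m by [].
move: E; rewrite /s /sbst; case: eqP => [_ E|_].
  by have := Penc_compl P X3 hX; rewrite E xX.
by case: eqP => // _ /compl_inj E; rewrite E eqxx in hx.
Qed.

(** Either a unit clause can be eliminated, or the single clause with [compl x] is binary and all
    propagation from [x] passes through it, so that [merge_input] applies. The last conclusion keeps
    other thin inputs thin. *)
Lemma thin_step phi X x : Penc w phi X -> 2 < #|X| -> x \in X ->
    #|occ phi (compl x)| <= 1 ->
  exists phi', [/\ Penc w phi' X, #|phi'| < #|phi|
    & forall h, h \in X -> h != x -> #|occ phi' (compl h)| <= #|occ phi (compl h)|].
Proof.
move=> P X3 xX o1.
have [l lP|nu] := pickP [pred l : lit V | [set l] \in phi].
  have [P' lt'] := unit_red P lP.
  by exists (red phi [set l]); split=> // h _ _; apply: occ_red_le.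
have [|y CP yx] := binary_clause P X3 xX; first by move=> l; apply/negbT/(nu l).
apply: (merge_input P X3 xX CP yx) => h hX hx.
apply: (up_via P X3 xX CP) => // C z CC xC nE _ _ _.
have : [set C; [set compl x; y]] \subset occ phi (compl x).
  by apply/subsetP => D /set2P[] ->; rewrite inE ?CC ?xC // CP set21.
by move/subset_leq_card; rewrite cards2 nE => /leq_trans/(_ o1).
Qed.

Lemma restrict_Penc phi X X' : Penc w phi X -> X' \subset X ->
  Penc w (red phi [set compl x | x in X :\: X']) X'.
Proof.
move=> P sX; apply: (red_Penc P sX) => g gX; have gX' := subsetP sX _ gX.
have [a Ha Hg] := Penc_model P gX'; exists a; split=> // _ /imsetP[x + ->].
rewrite inE => /andP[xX' xX]; rewrite eval_compl; apply: Penc_false P gX' xX _ Ha Hg.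
by apply: contraNneq xX' => <-.
Qed.

(** Setting [x] to false satisfies every clause with [compl x]; by the last conclusion an input
    sharing such a clause loses an occurrence. *)
Lemma remove_input phi X x : Penc w phi X -> x \in X ->
  exists phi', [/\ Penc w phi' (X :\ x), #|phi'| + #|occ phi (compl x)| <= #|phi|
    & forall h, #|occ phi' (compl h)| <= #|occ phi (compl h) :\: occ phi (compl x)|].
Proof.
move=> P xX; exists (red phi [set compl x | x in X :\: (X :\ x)]).
have -> : X :\: (X :\ x) = [set x].
  by rewrite setDDr setDv set0U; apply/setIidPr; rewrite sub1set.
have E : [set compl y | y in [set x]] = [set compl x] by rewrite imset_set1.
split; first by have := restrict_Penc P (subD1set X x); rewrite setDDr setDv set0U (setIidPr _) ?sub1set.
  apply: card_red => [|C]; first by apply/subsetP => C; rewrite inE => /andP[].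
  by rewrite E inE => /andP[_ xC]; rewrite disjoint_sym disjoints1 negbK.
move=> h; apply: leq_trans (occ_red _ _ _) _; apply: subset_leq_card.
apply/subsetP => C; rewrite E !inE disjoint_sym disjoints1 => /andP[/andP[-> ->]] ->.
by [].
Qed.

(* The term counting thin inputs makes the induction run: each application of
   thin_step saves one clause and spoils at most one thin input. *)
Lemma thin_bound phi X : Penc w phi X -> 2 < #|X| ->
  2 * #|X| - 3 + #|[set x in X | #|occ phi (compl x)| <= 1]| <= #|phi|.
Proof.
have [m] := ubnP #|phi|; elim: m => // m IH in phi X *; rewrite ltnS => le_m P X3.
have [x /andP[xX o1]|nt] := pickP [pred x | (x \in X) && (#|occ phi (compl x)| <= 1)].
  have [phi' [P' lt' oc]] := thin_step P X3 xX o1.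
  apply: (leq_trans _ lt').
  have /IH : #|phi'| < m by apply: leq_trans lt' _.
  move=> /(_ X P' X3); rewrite -ltnS; apply: leq_trans.
  rewrite -addnS leq_add2l (cardsD1 x) inE xX o1 add1n ltnS.
  apply: subset_leq_card; apply/subsetP => h; rewrite !inE => /and3P[hx hX oh].
  by rewrite hX (leq_trans (oc h hX hx)).
have -> : #|[set x in X | #|occ phi (compl x)| <= 1]| = 0.
  by apply: eq_card0 => x; rewrite inE; apply: nt.
have /card_gt0P[x xX] : 0 < #|X| by apply: leq_trans X3.
have o2 : 1 < #|occ phi (compl x)| by rewrite ltnNge; have := nt x; rewrite /= xX /= => ->.
have [phi' [P' lt' _]] := remove_input P xX.
have cX := cardsD1 x X; rewrite xX add1n in cX.
have [X4|X4] := ltnP 3 #|X|.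
  have X4' : 2 < #|X :\ x| by lia.
  have lt_m : #|phi'| < m by lia.
  by have := IH _ _ lt_m P' X4'; lia.
(* With three inputs, removing [x] saves two clauses and the two inputs left still need one:
   [3 = 2 * 3 - 3]. *)
have /card_gt0P[g gX'] : 0 < #|X :\ x| by lia.
have := cardsD1 g (X :\ x); rewrite gX' => cX'.
have /card_gt0P[h] : 0 < #|X :\ x :\ g| by lia.
rewrite !inE => /and3P[hg hx hX]; have hX' : h \in X :\ x by rewrite !inE hx.
suff : 0 < #|phi'| by lia.
have gh : g != h by rewrite eq_sym.
have hg' : compl h != g.
  apply: contraNneq (Penc_compl P X3 hX) => ->.
  by move: gX'; rewrite !inE => /andP[].
exact: up_gt0 (Penc_up P' gX' hX' gh) hg'.
Qed.

(** Lexicographic order on the number of clauses and the total length: the factor exceeds every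
    possible total length. The second component serves [minimal_shrink]. *)
Definition cost phi :=
  #|phi| * (#|{set lit V}| * #|lit V|).+1 + \sum_(C in phi) #|C|.

(** The input set varies as well, since identifying literals can move the inputs. *)
Definition minimal phi X := forall phi' X',
  Penc w phi' X' -> #|X'| = #|X| -> cost phi <= cost phi'.

Lemma cost_lt phi phi' : #|phi'| < #|phi| -> cost phi' < cost phi.
Proof.
move=> lt; rewrite /cost.
have : \sum_(C in phi') #|C| <= #|{set lit V}| * #|lit V|.
  apply: leq_trans (_ : \sum_(C in phi') #|lit V| <= _).
    by apply: leq_sum => C _; apply: max_card.
  by rewrite sum_nat_const leq_mul2r max_card orbT.
move: (#|{set lit V}| * #|lit V|) (\sum_(C in phi') _) (\sum_(C in phi) _) => M s1 s2 le.
have : #|phi'|.+1 * M.+1 <= #|phi| * M.+1 by rewrite leq_mul2r lt orbT.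
by rewrite mulSn; lia.
Qed.

Lemma minimal_card phi X phi' X' : minimal phi X -> Penc w phi' X' -> #|X'| = #|X| ->
  #|phi| <= #|phi'|.
Proof.
move=> M P' E; rewrite leqNgt; apply/negP => /cost_lt.
by rewrite ltnNge (M _ _ P' E).
Qed.

Lemma ex_minimal phi X : Penc w phi X ->
  exists phi' X', [/\ Penc w phi' X', #|X'| = #|X|, minimal phi' X' & #|phi'| <= #|phi|].
Proof.
have [m] := ubnP (cost phi); elim: m => // m IH in phi X *; rewrite ltnS => le_m P.
have [M|] := pselect (minimal phi X); first by exists phi, X.
move=> /existsNP[phi1 /existsNP[X1 /not_implyP[P1 /not_implyP[E1 /negP]]]].
rewrite -ltnNge => lt1; have [|phi2 [X2 [P2 E2 M2 le2]]] := IH phi1 X1 _ P1.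
  exact: leq_trans lt1 le_m.
exists phi2, X2; split=> //; first by rewrite E2.
apply: leq_trans le2 _; rewrite leqNgt; apply/negP => /cost_lt; lia.
Qed.

End Thin.


(** * Structure of minimal formulas and lower bounds in the regular case *)

Section Minimal.
Variables (V : finType) (w : nat) (phi : {set {set lit V}}) (X : {set lit V}).
Hypotheses (P : Penc w phi X) (M : minimal w phi X) (X3 : 2 < #|X|).
Implicit Types (C D T : {set lit V}) (g h k l u v x y z : lit V).

Lemma minimal_nounit l : [set l] \notin phi.
Proof.
apply/negP => lP; have [P' lt] := unit_red P lP.
by have := minimal_card M P' erefl; rewrite leqNgt lt.
Qed.

Lemma minimal_occ x : x \in X -> 1 < #|occ phi (compl x)|.
Proof.
move=> xX; rewrite ltnNge; apply/negP => o1.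
have [phi' [P' lt _]] := thin_step P X3 xX o1.
by have := minimal_card M P' erefl; rewrite leqNgt lt.
Qed.

(** Replacing [C] by the pair keeps a P-encoding: models of [x] satisfy [z] by propagation, models
    of other inputs falsify [x], and propagation survives by [up_subsume]. *)
Lemma minimal_shrink x z C : x \in X -> C \in phi -> compl x \in C -> z \in C ->
    (forall k, k \in C -> k != z -> up phi x (compl k)) -> C = [set compl x; z].
Proof.
move=> xX CP xC zC fz; apply/eqP; apply: contraT => nE.
have sD : [set compl x; z] \proper C.
  by rewrite properEneq eq_sym nE; apply/subsetP => k /set2P[] ->.
set D := [set compl x; z] in nE sD.
pose phi' : {set {set lit V}} := D |: (phi :\ C).
have cP : #|phi| = (#|phi :\ C|).+1 by rewrite (cardsD1 C) CP.
have P' : Penc w phi' X.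
  have Hm a g : g \in X -> eval_cnf a phi -> eval_lit a g -> eval_cnf a phi'.
    move=> gX Ha Hg; apply/eval_cnfP => E /setU1P[->|]; last first.
      by rewrite inE => /andP[_ EP]; have /eval_cnfP/(_ E EP) := Ha.
    have [gx|gx] := eqVneq g x.
      exists z; first by rewrite set22.
      rewrite gx in Hg; apply: (up_sound Ha Hg); exact: (up_step CP zC fz).
    exists (compl x); first by rewrite set21.
    by rewrite eval_compl; apply: (Penc_false P gX xX gx Ha Hg).
  split.
  - apply/forall_inP => E /setU1P[->|/setD1P[_ EP]]; last exact: (Penc_clause P EP).
    exact: (is_clauseS (proper_sub sD) (Penc_clause P CP)).
  - move=> E /setU1P[->|/setD1P[_ EP]]; last by apply: (Penc_width P EP).
    exact: (leq_trans (subset_leq_card (proper_sub sD)) (Penc_width P CP)).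
  - by move=> g gX; have [a Ha Hg] := Penc_model P gX; exists a; rewrite ?(Hm a g).
  move=> g h gX hX gh; have [a Ha Hg] := Penc_model P gX.
  apply: (@up_subsume _ a phi phi') => //; [|exact: (Hm a g gX Ha Hg)|exact: (Penc_up P gX hX gh)].
  move=> E EP; have [->|nEC] := eqVneq E C.
    by exists D; [rewrite setU11|apply: proper_sub].
  by exists E => //; rewrite !inE nEC EP orbT.
have := M P' erefl; rewrite leqNgt => /negP[].
(* If the pair was already a clause, the number of clauses drops; otherwise the total length
   does. *)
have [DP|DP] := boolP (D \in phi :\ C).
  by apply: cost_lt; rewrite /phi' (setUidPr _) ?sub1set // cP.
rewrite /cost /phi' cardsU1 DP add1n -cP ltn_add2l (big_setU1 D) //= (big_setD1 C CP) /=.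
by rewrite ltn_add2r; apply: proper_card.
Qed.

(** One of the two occurrences is binary by [binary_clause]. If the other fires from [x], minimality
    shrinks it to a pair; if it never does, [merge_input] would save a clause. *)
Lemma minimal_binary x C : x \in X -> #|occ phi (compl x)| = 2 ->
    C \in phi -> compl x \in C ->
  exists2 y, C = [set compl x; y] & y != compl x.
Proof.
move=> xX o2 CP xC.
have [y yP yx] := binary_clause P X3 xX minimal_nounit.
have [->|nE] := eqVneq C [set compl x; y]; first by exists y.
have [[z [zC zx fz]]|nf] := pselect (exists z, [/\ z \in C, z != compl x
    & forall k, k \in C -> k != z -> up phi x (compl k)]).
  by exists z => //; apply: minimal_shrink.
have [|phi' [P' lt _]] := merge_input P X3 xX yP yx; last first.
  by have := minimal_card M P' erefl; rewrite leqNgt lt.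
move=> h hX hx; apply: (up_via P X3 xX yP) => // E z EP xE nEy zE zx fz.
suff E_C : E = C by apply: nf; exists z; rewrite -E_C.
apply/eqP; apply: contraT => nEC.
have : [set E; C; [set compl x; y]] \subset occ phi (compl x).
  by apply/subsetP => F; rewrite !inE => /orP[/orP[]|] /eqP ->; rewrite ?EP ?CP ?yP ?xE ?xC ?set21.
move/subset_leq_card; rewrite o2 setUC cardsU1 cards2 nEC !inE negb_or.
by rewrite ![[set compl x; y] == _]eq_sym nEy nE.
Qed.

(** The inequality excludes the case where the pair collapses to a unit clause. *)
Definition nb x : {set lit V} := [set y | ([set compl x; y] \in phi) && (y != compl x)].
Definition inputs y : {set lit V} := [set x in X | y \in nb x].
Definition aux l := (l \notin X) && (compl l \notin X).
Definition covers (Z : {set lit V}) : {set {set lit V}} :=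
  [set C in phi | [exists x in Z, compl x \in C]].
Definition rest : {set {set lit V}} := phi :\: covers X.

Lemma aux_compl l : aux (compl l) = aux l.
Proof. by rewrite /aux complK andbC. Qed.

Hypotheses (O2 : forall x, x \in X -> #|occ phi (compl x)| = 2).
Hypotheses (N2 : forall x h, x \in X -> h \in X -> [set compl x; compl h] \notin phi).

Lemma nb_clause x y : y \in nb x -> [set compl x; y] \in phi.
Proof. by rewrite inE => /andP[]. Qed.

Lemma clause_nb x C : x \in X -> C \in phi -> compl x \in C ->
  exists2 y, y \in nb x & C = [set compl x; y].
Proof.
move=> xX CP xC; have [y E yx] := minimal_binary xX (O2 xX) CP xC.
by exists y => //; rewrite inE -E CP.
Qed.

Lemma card_nb x : x \in X -> #|nb x| = 2.
Proof.
move=> xX; rewrite -(O2 xX).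
rewrite -(@card_in_imset _ _ (fun y => [set compl x; y]) (nb x)); last first.
  move=> y z; rewrite !inE => /andP[_ yx] _ /setP/(_ y).
  by rewrite !inE eqxx orbT (negPf yx) => /esym/eqP.
congr #|pred_of_set _|; apply/setP => C; rewrite inE; apply/imsetP/andP.
  by case=> y yN ->; rewrite nb_clause // set21.
by case=> CP xC; have [y yN ->] := clause_nb xX CP xC; exists y.
Qed.

Lemma nb_aux x y : x \in X -> y \in nb x -> aux y.
Proof.
move=> xX yN; have yP := nb_clause yN; apply/andP; split.
  apply/negP => yX; have [a Ha Hx] := Penc_model P xX.
  have xy : x != y by rewrite eq_sym (Penc_pair_compl P yP).
  by have := Penc_false P xX yX xy Ha Hx; rewrite (eval_pair Ha yP Hx).
by apply/negP => /(N2 xX); rewrite complK yP.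
Qed.

Lemma input_not_aux x : x \in X -> ~~ aux x.
Proof. by rewrite /aux => ->. Qed.

Lemma cinput_not_aux x : x \in X -> ~~ aux (compl x).
Proof. by rewrite aux_compl; apply: input_not_aux. Qed.

Lemma nb_true a x y : eval_cnf a phi -> eval_lit a x -> y \in nb x -> eval_lit a y.
Proof. by move=> Ha Hx /nb_clause yP; apply: (eval_pair Ha yP Hx). Qed.

(** Each input has two clauses, and none is counted twice because the second literal of such a
    clause is auxiliary. *)
Lemma card_covers (Z : {set lit V}) : Z \subset X -> 2 * #|Z| <= #|covers Z|.
Proof.
move=> sZ; have -> : 2 * #|Z| = \sum_(x in Z) #|occ phi (compl x)|.
  rewrite mulnC -sum_nat_const; apply: eq_bigr => x xZ.
  by rewrite O2 // (subsetP sZ).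
have -> : \sum_(x in Z) #|occ phi (compl x)| = \sum_(x in Z) \sum_(C in phi) (compl x \in C : nat).
  apply: eq_bigr => x _; rewrite -sum1_card big_mkcond [RHS]big_mkcond /=.
  by apply: eq_bigr => C _; rewrite inE; case: (C \in phi); case: (_ \in C).
rewrite exchange_big /= -sum1_card [leqRHS]big_mkcond [leqLHS]big_mkcond /=.
apply: leq_sum => C _; rewrite inE; case: ifP => //= CP.
case: ifP => [|/negbT nx]; last first.
  rewrite big1 // => x xZ; apply/eqP; rewrite eqb0; apply: contra nx => xC.
  by apply/exists_inP; exists x.
case/exists_inP => x xZ xC; rewrite (bigD1 x) //= xC big1 // => h /andP[hZ hx].
apply/eqP; rewrite eqb0; apply/negP => hC.
have [y yN E] := clause_nb (subsetP sZ _ xZ) CP xC.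
move: hC; rewrite E !inE (inj_eq (@compl_inj _)) (negPf hx) => /eqP hy.
by have := nb_aux (subsetP sZ _ xZ) yN; rewrite -hy (negPf (cinput_not_aux (subsetP sZ _ hZ))).
Qed.

Lemma card_rest : 2 * #|X| + #|rest| <= #|phi|.
Proof.
rewrite -(cardsID (covers X) phi) leq_add2r (setIidPr _); first exact: card_covers.
by apply/subsetP => C; rewrite inE => /andP[].
Qed.

(* Keep only the inputs that imply y and set y to true: every remaining input
   has lost one of its two clauses. *)
Lemma degree_bound y l (Q : {set {set lit V}}) : 2 < #|inputs y| ->
    (forall a, eval_cnf a phi -> eval_lit a y -> eval_lit a l) ->
    (forall C, C \in Q -> (C \in rest) && (l \in C)) ->
  2 * #|X| + 2 * #|inputs y| - 3 + #|Q| <= #|phi|.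
Proof.
move=> d3 Hl HQ; set Y := inputs y.
have sY : Y \subset X by apply/subsetP => x; rewrite inE => /andP[].
have nbY x : x \in Y -> y \in nb x by rewrite inE => /andP[].
(* [l] follows from [y], so it may be set to true too, which also satisfies the clauses of [Q]. The
   plain bound is [l = y] with [Q] empty. *)
pose T := [set y; l] :|: [set compl x | x in X :\: Y].
pose R := [set [set compl x; y] | x in Y].
have P1 : Penc w (red phi T) Y.
  apply: (red_Penc P sY) => g gY; have gX := subsetP sY _ gY.
  have [a Ha Hg] := Penc_model P gX; exists a; split=> // t.
  have Hy : eval_lit a y := nb_true Ha Hg (nbY _ gY).
  rewrite !inE => /orP[/orP[]/eqP->//|/imsetP[x + ->]]; first exact: Hl.
  rewrite inE => /andP[xY xX]; rewrite eval_compl; apply: (Penc_false P gX xX _ Ha Hg).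
  by apply: contraNneq xY => <-.
have cR : #|R| = #|Y|.
  apply: card_in_imset => x x' xY _ /setP/(_ (compl x)).
  rewrite !inE eqxx (inj_eq (@compl_inj _)) => /esym/orP[/eqP//|/eqP E].
  have := nb_aux (subsetP sY _ xY) (nbY _ xY).
  by rewrite -E (negPf (cinput_not_aux (subsetP sY _ xY))).
have sR : R \subset phi by apply/subsetP => _ /imsetP[x /nbY xY ->]; apply: nb_clause.
have RcovX C : C \in R -> C \in covers X.
  move=> /[dup] /(subsetP sR) CP /imsetP[x xY E]; rewrite inE CP.
  by apply/exists_inP; exists x; rewrite ?(subsetP sY) // E set21.
have dR : [disjoint covers (X :\: Y) & R].
  apply/pred0Pn => -[C /andP[/= + /imsetP[x xY E]]].
  rewrite inE => /andP[_ /exists_inP[h]]; rewrite inE => /andP[hY hX].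
  rewrite E !inE (inj_eq (@compl_inj _)) => /orP[]/eqP E'; first by rewrite E' xY in hY.
  have := nb_aux (subsetP sY _ xY) (nbY _ xY).
  by rewrite -E' (negPf (cinput_not_aux hX)).
have dQ : [disjoint covers (X :\: Y) :|: R & Q].
  apply/pred0Pn => -[C /andP[/= + /HQ/andP[/setDP[CP nC] _]]]; apply/negP.
  apply: contra nC => /setUP[|/RcovX//]; rewrite !inE => /andP[-> /exists_inP[h]].
  by rewrite inE => /andP[_ hX] hC; apply/exists_inP; exists h.
have cQ : 2 * (#|X| - #|Y|) + #|Y| + #|Q| <= #|covers (X :\: Y) :|: R :|: Q|.
  rewrite cardsU (disjoint_setI0 dQ) cards0 subn0 leq_add2r.
  rewrite cardsU (disjoint_setI0 dR) cards0 subn0 cR leq_add2r.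
  by have := card_covers (subsetDl X Y); rewrite cardsD (setIidPr sY).
have c1 : #|red phi T| + #|covers (X :\: Y) :|: R :|: Q| <= #|phi|.
  apply: card_red.
    rewrite !subUset sR /= andbC; apply/andP; split.
      by apply/subsetP => C /HQ/andP[/setDP[]].
    by rewrite andbT; apply/subsetP => C; rewrite inE => /andP[].
  move=> C; rewrite in_setU => /orP[|/HQ/andP[_ lC]]; last first.
    by apply/pred0Pn; exists l; rewrite /= lC !inE eqxx orbT.
  rewrite in_setU => /orP[|/imsetP[x _ ->]]; last first.
    by apply/pred0Pn; exists y; rewrite /= !inE eqxx orbT.
  rewrite inE => /andP[_ /exists_inP[x xZ xC]].
  by apply/pred0Pn; exists (compl x); rewrite /= xC inE imset_f ?orbT.
(* All inputs of [Y] are now thin, so at least [3 * #|Y| - 3] clauses remain;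
   [2 * (#|X| - #|Y|) + #|Y| + #|Q|] were satisfied. *)
have := thin_bound P1 d3.
have -> : [set x in Y | #|occ (red phi T) (compl x)| <= 1] = Y.
  apply/setP => x; rewrite inE andb_idr // => xY; have xX := subsetP sY _ xY.
  apply: (leq_trans (occ_red _ _ _) _).
  have -> : 1 = #|occ phi (compl x) :\ [set compl x; y]|.
    have := cardsD1 [set compl x; y] (occ phi (compl x)).
    by rewrite O2 // inE (nb_clause (nbY _ xY)) set21 => -[].
  apply: subset_leq_card; apply/subsetP => C; rewrite inE => /andP[CO dC].
  rewrite in_setD1 CO andbT; apply: contraTneq dC => ->.
  by apply/pred0Pn; exists y; rewrite /= !inE eqxx orbT.
have := subset_leq_card sY; rewrite -/Y in d3; lia.
Qed.

(** Here [k] refutes [h] through the clauses of these two inputs alone. *)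
Definition kills h k := [exists y in nb h, compl y \in nb k].

Lemma kills_sym h k : kills h k = kills k h.
Proof.
by apply/exists_inP/exists_inP => -[y yN cN]; exists (compl y); rewrite ?complK.
Qed.

Variable D : nat.
Hypothesis degD : forall y, #|inputs y| <= D.

Lemma card_inputs2 (A : {set lit V}) u v :
  (forall k, k \in A -> k \in X /\ (u \in nb k \/ v \in nb k)) -> #|A| <= 2 * D.
Proof.
move=> H; apply: (leq_trans _ (_ : #|inputs u :|: inputs v| <= _)).
  apply: subset_leq_card; apply/subsetP => k /H[kX]; rewrite !inE kX.
  by case=> ->; rewrite ?orbT.
apply: (leq_trans (leq_card_setU _ _) _); rewrite mul2n -addnn.
by apply: leq_add; apply: degD.
Qed.

Lemma card_kills h : h \in X -> #|[set k in X | kills h k]| <= 2 * D.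
Proof.
move=> hX; have /eqP/cards2P[u [v [_ E]]] := card_nb hX.
apply: (@card_inputs2 _ (compl u) (compl v)) => k; rewrite inE => /andP[kX].
case/exists_inP => y; rewrite E => /set2P[]-> H; split=> //; by [left|right].
Qed.

(** The closure of [k] under propagation through clauses with a negated input, that is, without
    [rest]. *)
Definition direct k : {set lit V} :=
  k |: nb k :|: [set compl h | h in [set h in X :\ k | kills h k]].

Definition fires k C := [exists l in C, [&& aux l, l \notin direct k &
  [forall m in C, (m != l) ==> (compl m \in direct k)]]].

Lemma direct_up k l : k \in X -> l \in direct k -> up phi k l.
Proof.
move=> kX /setUP[/setU1P[->|lN]|/imsetP[h + ->]]; first exact: up_start.
  apply: (up_bin (nb_clause lN) _); exact: up_start.
rewrite inE => /andP[/setD1P[hk hX] /exists_inP[y yh yk]].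
have H := nb_clause yh; rewrite setUC -{1}[y]complK in H.
apply: (up_bin H _); apply: (up_bin (nb_clause yk) _); exact: up_start.
Qed.

Lemma direct_aux k l : k \in X -> aux l -> l \in direct k -> l \in nb k.
Proof.
move=> kX al /setUP[/setU1P[E|//]|/imsetP[h + E]].
  by move: al; rewrite E (negPf (input_not_aux kX)).
rewrite inE => /andP[/setD1P[_ hX] _].
by move: al; rewrite E (negPf (cinput_not_aux hX)).
Qed.

Lemma direct_input k h : k \in X -> h \in X -> h \in direct k -> h = k.
Proof.
move=> kX hX /setUP[/setU1P[//|/nb_aux]|/imsetP[g + E]].
  by rewrite (negPf (input_not_aux hX)) => /(_ kX).
rewrite inE => /andP[/setD1P[_ gX] _].
by have := Penc_compl P X3 gX; rewrite -E hX.
Qed.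

Lemma direct_cinput k h : k \in X -> h \in X -> compl h \in direct k -> kills h k.
Proof.
move=> kX hX /setUP[/setU1P[E|/nb_aux]|/imsetP[g + /(@compl_inj _) ->]].
- by have := Penc_compl P X3 hX; rewrite E kX.
- by rewrite (negPf (cinput_not_aux hX)) => /(_ kX).
by rewrite inE => /andP[].
Qed.

(** At most [2 * D] inputs are killed by [k], so the negation of some input is outside [direct k]
    and propagation must leave this set. *)
Lemma exists_fires k : 2 * D + 1 < #|X| -> k \in X -> exists2 C, C \in rest & fires k C.
Proof.
move=> DX kX.
have [h /setD1P[hk hX] hd] : exists2 h, h \in X :\ k & compl h \notin direct k.
  apply/exists_inP; rewrite -negb_forall_in; apply: contraTN DX => /forall_inP H.
  rewrite -leqNgt (cardsD1 k) kX addnC leq_add2r.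
  apply: (leq_trans _ (card_kills kX)); apply: subset_leq_card.
  apply/subsetP => h hX'; have /setD1P[_ hX] := hX'; rewrite inE hX kills_sym.
  exact: (direct_cinput kX hX (H h hX')).
have kh : k != h by rewrite eq_sym.
have kd : k \in direct k by rewrite !inE eqxx.
have [C [l [CP lC ld HC]]] := first_firing (Penc_up P kX hX kh) kd hd.
have [a Ha Hk] := Penc_model P kX.
have Hl : eval_lit a l.
  apply: (up_sound Ha Hk); apply: (up_step CP lC _) => m mC ml.
  exact: (direct_up kX (HC m mC ml)).
(* [direct k] is closed under the clauses of the inputs, so the first clause leaving it is none of
   them. *)
have CR : C \in rest.
  rewrite in_setD CP andbT inE CP /=; apply/exists_inPn => g gX; apply/negP => gC.
  have [y yN E] := clause_nb gX CP gC.
  have ay := nb_aux gX yN.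
  move: lC; rewrite E => /set2P[] El.
    have gk : g != k by apply: contraTneq Hl => E'; rewrite El E' eval_compl Hk.
    case/negP: ld; rewrite El inE; apply/orP; right; apply: imset_f.
    rewrite !inE gk gX /=; apply/exists_inP; exists y => //.
    apply: direct_aux => //; first by rewrite aux_compl.
    apply: HC; first by rewrite E set22.
    by rewrite El; apply: contraTneq ay => ->; apply: cinput_not_aux.
  have gd : g \in direct k.
    rewrite -[g]complK; apply: HC => //; rewrite El.
    by apply: contraTneq ay => <-; apply: cinput_not_aux.
  by case/negP: ld; rewrite El -(direct_input kX gX gd) /direct in_setU in_setU1 yN orbT.
exists C => //; apply/exists_inP; exists l => //; rewrite ld /=.
apply/andP; split; last by apply/forall_inP => m mC; apply/implyP; apply: HC.
rewrite /aux; apply/andP; split; last first.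
  apply/negP => lX; move: CR; rewrite in_setD CP andbT inE CP => /exists_inPn/(_ _ lX).
  by rewrite complK lC.
apply/negP => lX; have kl : k != l by apply: contraNneq ld => <-.
by have := Penc_false P kX lX kl Ha Hk; rewrite Hl.
Qed.

(** If [C] has two auxiliary literals, an input firing [C] directly implies the negation of one of
    them. Otherwise [C] contains an input, which every input firing [C] must kill. *)
Lemma card_fires C : C \in rest -> #|[set k in X | fires k C]| <= 2 * D.
Proof.
move=> CR; have /setDP[CP nC] := CR.
have nX l : l \in C -> compl l \notin X.
  move=> lC; apply/negP => lX; case/negP: nC; rewrite inE CP.
  by apply/exists_inP; exists (compl l); rewrite ?complK.
have [->|[k0]] := set_0Vmem [set k in X | fires k C]; first by rewrite cards0.
rewrite inE => /andP[k0X /exists_inP[u uC /and3P[au _ _]]].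
have [v vC vu] : exists2 v, v \in C & v != u.
  apply/exists_inP; apply: contraT => /exists_inPn H.
  case/negP: (minimal_nounit u); suff <- : C = [set u] by [].
  apply/setP => m; rewrite inE; apply/idP/eqP => [/H|->//].
  by rewrite negbK => /eqP.
have [[v' [v'C v'u av']]|nv] := pselect (exists v, [/\ v \in C, v != u & aux v]).
  apply: (@card_inputs2 _ (compl u) (compl v')) => k; rewrite inE => /andP[kX].
  case/exists_inP => l lC /and3P[al ld /forall_inP H]; split=> //.
  have [E|ul] := eqVneq u l; [right|left].
    apply: direct_aux; rewrite ?aux_compl //.
    by have := H v' v'C; rewrite -E v'u.
  apply: direct_aux; rewrite ?aux_compl //.
  by have := H u uC; rewrite ul.
have vX : v \in X.
  by apply: contraT => vX; case: nv; exists v; rewrite /aux vX nX.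
apply: (leq_trans _ (card_kills vX)); apply: subset_leq_card.
apply/subsetP => k; rewrite !inE => /andP[kX /exists_inP[l lC /and3P[al ld /forall_inP H]]].
rewrite kX /=; apply: direct_cinput => //.
have lv : v != l by apply: contraTneq al => <-; apply: input_not_aux.
by have := H v vC; rewrite lv.
Qed.

Lemma rest_bound : 2 * D + 1 < #|X| -> #|X| <= #|rest| * (2 * D).
Proof.
move=> DX; rewrite -sum1_card.
apply: (leq_trans _ (_ : \sum_(k in X) \sum_(C in rest) (fires k C : nat) <= _)).
  apply: leq_sum => k kX; have [C CR fC] := exists_fires DX kX.
  by rewrite (bigD1 C) //= fC.
rewrite exchange_big /= -sum_nat_const; apply: leq_sum => C CR.
apply: (leq_trans _ (card_fires CR)); rewrite -sum1_card [leqRHS]big_mkcond [leqLHS]big_mkcond /=.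
by apply: leq_sum => k _; rewrite inE; case: (k \in X); case: (fires k C).
Qed.

End Minimal.


(** * The lower bound for arbitrary P-encodings *)

Definition regular (V : finType) (phi : {set {set lit V}}) (X : {set lit V}) : Prop :=
  (forall x, x \in X -> #|occ phi (compl x)| = 2) /\
  (forall x h, x \in X -> h \in X -> [set compl x; compl h] \notin phi).

Lemma regular_or_smaller (V : finType) w (phi : {set {set lit V}}) X :
  Penc w phi X -> minimal w phi X -> 3 < #|X| ->
  regular phi X \/ exists (phi' : {set {set lit V}}) (X' : {set lit V}),
    [/\ Penc w phi' X', #|X'| = #|X|.-1 & #|phi'| + 3 <= #|phi|].
Proof.
move=> P M X4; have X3 : 2 < #|X| by apply: ltnW.
have cX x : x \in X -> #|X :\ x| = #|X|.-1 by move=> xX; rewrite (cardsD1 x X) xX.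
have [x /andP[xX o2]|O2] := pickP [pred x | (x \in X) && (#|occ phi (compl x)| != 2)].
  right; have [phi' [P' le' _]] := remove_input P xX.
  exists phi', (X :\ x); split; rewrite ?cX //; apply: leq_trans le'.
  by rewrite leq_add2l ltn_neqAle eq_sym o2 (minimal_occ P).
have {}O2 x : x \in X -> #|occ phi (compl x)| = 2.
  by move=> xX; have := O2 x; rewrite /= xX => /negbFE/eqP.
have [[x h] /and3P[/= xX hX xh]|N2] :=
    pickP [pred p | [&& p.1 \in X, p.2 \in X & [set compl p.1; compl p.2] \in phi]].
  right; have [phi' [P' le' oc]] := remove_input P xX.
  have hx : h != x.
    by apply: contraTneq xh => ->; rewrite setUid; apply: (minimal_nounit P).
  have hX' : h \in X :\ x by rewrite !inE hx.
  have X3' : 2 < #|X :\ x| by rewrite cX //; lia.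
  (* Removing [x] saved two clauses; [h] lost the clause shared with [x], so it is thin and yields
     the third. *)
  have [|phi2 [P2 lt2 _]] := thin_step P' X3' hX'.
    apply: leq_trans (oc h) _.
    have -> : 1 = #|occ phi (compl h) :\ [set compl x; compl h]|.
      have := cardsD1 [set compl x; compl h] (occ phi (compl h)).
      by rewrite O2 // inE xh set22 => -[].
    apply: subset_leq_card; apply/subsetP => C /setDP[hC nC].
    rewrite in_setD1 hC andbT; apply: contraNneq nC => ->.
    by rewrite inE xh set21.
  exists phi2, (X :\ x); rewrite cX //; split=> //.
  by rewrite (O2 x xX) in le'; apply: leq_trans le'; rewrite addn3 addn2 !ltnS.
left; split=> // x h xX hX.
by have := N2 (x, h); rewrite /= xX hX /= => ->.
Qed.

(* For n >= 9 this is 2n + sqrt n - 2 <= s; the first conjunct guards the truncated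
   subtraction. *)
Definition size_bound n s :=
  if n <= 8 then 3 * n - 6 <= s else (2 * n <= s + 2) && (n <= (s + 2 - 2 * n) ^ 2).

Lemma size_bound_leq n s s' : s <= s' -> size_bound n s -> size_bound n s'.
Proof.
rewrite /size_bound => le; case: ifP => [_ /leq_trans|_ /andP[le1 le2]]; first exact.
rewrite (leq_trans le1) ?leq_add2r //= (leq_trans le2) // leq_exp2r //.
by rewrite leq_sub2r // leq_add2r.
Qed.

(** Three clauses for one input raise the excess over [2 * n] by one, and [r ^ 2 >= n - 1] gives
    [(r + 1) ^ 2 >= n]. *)
Lemma size_bound_step n s s' : 3 < n -> size_bound n.-1 s -> s + 3 <= s' -> size_bound n s'.
Proof.
move=> n4 gs le; apply: size_bound_leq le _; move: gs; rewrite /size_bound.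
have [n8|n8] := leqP n 8; first by rewrite ifT; lia.
have [n8'|n8'] := leqP n.-1 8; first by have -> : n = 9; [lia | move=> /= ?; nia].
case/andP=> le1 le2; apply/andP; split; first lia.
have -> : s + 3 + 2 - 2 * n = (s + 2 - 2 * n.-1).+1 by lia.
move: (s + 2 - 2 * n.-1) le2 => r; nia.
Qed.

(** [D] is the largest number of inputs implying one literal and [r] the number of remaining
    clauses. In the main case, with [q = s + 2 - 2 * n], one has [2 * D <= q + 1] and [r <= q - 2],
    so [n <= (q - 2) * (q + 1) <= q ^ 2]. *)
Lemma size_bound_regular n s r D : 3 < n -> 2 * n + r <= s -> (2 < D -> 2 * n + 2 * D - 3 <= s) ->
  (2 * D + 1 < n -> n <= r * (2 * D)) -> size_bound n s.
Proof.
move=> n4 le1 le2 le3; rewrite /size_bound.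
have [n6|n6] := leqP n 6; first by rewrite ifT; lia.
have [n8|n8] := leqP n 8.
  have [D3|D3] := ltnP 2 D; first by have := le2 D3; lia.
  have DX : 2 * D + 1 < n by lia.
  have r2 : 1 < r by have := le3 DX; nia.
  lia.
apply/andP; split; first lia.
have [D3|D3] := ltnP 2 D; last first.
  have /le3 le4 : 2 * D + 1 < n by lia.
  have le5 : n <= r * 4 by nia.
  have : r + 2 <= s + 2 - 2 * n by lia.
  move: (s + 2 - 2 * n) => q; nia.
have le4 : 2 * D <= (s + 2 - 2 * n) + 1 by have := le2 D3; lia.
have le5 : r + 2 <= s + 2 - 2 * n by lia.
move: (s + 2 - 2 * n) le4 le5 => q le4 le5.
have [DX|DX] := ltnP (2 * D + 1) n; last nia.
have := le3 DX; have : r * (2 * D) <= (q - 2) * (q + 1) by apply: leq_mul; lia.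
nia.
Qed.

Lemma general_bound (V : finType) w (phi : {set {set lit V}}) X :
  Penc w phi X -> 2 < #|X| -> size_bound #|X| #|phi|.
Proof.
have [n] := ubnP #|X|; elim: n => // n IH in phi X *; rewrite ltnS => le_n P X3.
have [X4|X4] := ltnP 3 #|X|; last first.
  have := thin_bound P X3; have -> : #|X| = 3 by lia.
  by rewrite /size_bound /=; lia.
have [phi1 [X1 [P1 E1 M1 /size_bound_leq]]] := ex_minimal P; apply; rewrite -E1 in le_n X3 X4 *.
case: (regular_or_smaller P1 M1 X4) => [[O2 N2]|[phi2 [X2 [P2 E2 le2]]]]; last first.
  by apply: size_bound_step le2 => //; rewrite -E2; apply: IH => //; lia.
pose D := \max_y #|inputs phi1 X1 y|.
have degD y : #|inputs phi1 X1 y| <= D by apply: leq_bigmax.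
apply: (@size_bound_regular _ _ #|rest phi1 X1| D) => //.
- exact: card_rest P1 M1 X3 O2 N2.
- move=> D3; have lit0 : 0 < #|lit V|.
    by apply: leq_trans (max_card (mem X1)); apply: leq_trans X3.
  have [y E] := bigop.eq_bigmax (fun y => #|inputs phi1 X1 y|) lit0.
  rewrite -/D in E.
  have := @degree_bound _ _ _ _ P1 M1 X3 O2 N2 y y set0; rewrite cards0 addn0 -E.
  by apply=> // C; rewrite inE.
- exact: rest_bound P1 M1 X3 O2 N2 _ degD.
Qed.


(** * The lower bound for 2-CNF P-encodings, via the implication graph *)

Section TwoCNF.
Variables (V : finType) (phi : {set {set lit V}}) (X : {set lit V}).
Hypotheses (P : Penc 2 phi X) (M : minimal 2 phi X) (X3 : 2 < #|X|).
Hypothesis (reg : regular phi X).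
Implicit Types (C T : {set lit V}) (g h k l u v x y z : lit V) (a b : {ffun V -> bool}).

Let O2 := reg.1.
Let N2 := reg.2.
Let clauseNb := clause_nb P M X3 O2.
Let nbAux := nb_aux P N2.

Lemma two_clause C l : C \in phi -> l \in C ->
  exists2 k, C = [set k; l] & k != l.
Proof.
move=> CP lC; have [E|[k]] := set_0Vmem (C :\ l).
  have EC : C = [set l] by rewrite -(setD1K lC) E setU0.
  by have := minimal_nounit P M l; rewrite -EC CP.
case/setD1P => kl kC; exists k => //; apply/esym/eqP; rewrite eqEcard cards2 kl.
rewrite (Penc_width P CP) andbT; apply/subsetP => m /set2P[] -> //.
Qed.

Definition imp : rel (lit V) := fun u v => [set compl u; v] \in phi.

Lemma connect_up u v : connect imp u v -> up phi u v.
Proof.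
case/connectP => p + ->; elim: p u => [|m p IH] u /=; first by move=> _; apply: up_start.
case/andP => um /IH; apply: up_trans; apply: up_bin um _; exact: up_start.
Qed.

Lemma connect_sound a u v : eval_cnf a phi -> connect imp u v -> eval_lit a u -> eval_lit a v.
Proof. by move=> Ha /connect_up H Hu; apply: up_sound Ha Hu H. Qed.

(** Literals on a cycle agree in every model, so merging them would save a clause. *)
Lemma imp_acyclic u v : imp u v -> ~~ connect imp v u.
Proof.
move=> uv; apply/negP => vu.
have vCu : v != compl u.
  by apply: contraTneq uv => ->; rewrite /imp setUid; apply: (minimal_nounit P M).
have [|P' E' lt'] := merge_Penc P uv vCu.
  move=> g gX; have [a Ha Hg] := Penc_model P gX; exists a; split=> //.
  by apply/idP/idP; [apply: connect_sound | apply: eval_pair uv].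
by have := minimal_card M P' E'; rewrite leqNgt lt'.
Qed.

(** Take [y] reaching the most literals. Another candidate [u] reaching [y] would reach the same
    ones, hence be reached by [y] and close a cycle. *)
Lemma exists_source : exists2 y, 0 < #|inputs phi X y| &
  forall u, 0 < #|inputs phi X u| -> connect imp u y -> u = y.
Proof.
have /card_gt0P[x xX] : 0 < #|X| by apply: leq_trans X3.
have /card_gt0P[z zN] : 0 < #|nb phi x| by rewrite (card_nb P M X3 O2).
have z0 : 0 < #|inputs phi X z| by apply/card_gt0P; exists x; rewrite inE xX.
case: (@arg_maxnP _ z (fun y => 0 < #|inputs phi X y|) (fun y => #|[set v | connect imp y v]|) z0).
move=> y y0 ymax; exists y => // u u0 uy; apply/eqP; apply: contraT => nuy.
have yu : connect imp y u.
  have : [set v | connect imp y v] \subset [set v | connect imp u v].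
    by apply/subsetP => v; rewrite !inE; apply: connect_trans.
  have le : #|[set v | connect imp u v]| <= #|[set v | connect imp y v]| := ymax u u0.
  move/subset_leqif_card/geq_leqif; rewrite le => /esym/subsetP/(_ u).
  by rewrite !inE connect0 => /(_ isT).
case/connectP: uy => -[|v p] /=; first by move=> _ E; rewrite E eqxx in nuy.
case/andP => uv vp yE; case/negP: (imp_acyclic uv).
by apply: connect_trans yu; apply/connectP; exists p.
Qed.

(** Otherwise [y] could be set to true, which removes the clause from [x] to [y]. *)
Lemma minimal_unforced x y : imp x y -> exists2 b, eval_cnf b phi & ~~ eval_lit b y.
Proof.
move=> xy; have [//|nb] := pselect (exists2 b, eval_cnf b phi & ~~ eval_lit b y).
have P' : Penc 2 (red phi [set y]) X.
  apply: (red_Penc P (subxx _)) => g gX; have [a Ha Hg] := Penc_model P gX.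
  exists a; split=> // t /set1P ->; apply: contraT => ny.
  by case: nb; exists a.
have := minimal_card M P' erefl.
have := @card_red _ phi [set y] [set [set compl x; y]].
rewrite cards1 sub1set => /(_ xy) H H'.
suff : #|red phi [set y]| + 1 <= #|phi| by rewrite addn1 ltnNge H'.
by apply: H => C /set1P ->; rewrite disjoint_sym disjoints1 set22.
Qed.

(** Glue a model [a] of [k] and a model [b] falsifying [y]: follow [b] on the variables of literals
    that reach [y], and [a] elsewhere. Since [y] is a source that [k] does not imply directly, [k]
    does not reach [y]. *)
Lemma source_false y k : 0 < #|inputs phi X y| ->
    (forall u, 0 < #|inputs phi X u| -> connect imp u y -> u = y) ->
    k \in X -> k \notin inputs phi X y ->
  exists a, [/\ eval_cnf a phi, eval_lit a k & ~~ eval_lit a y].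
Proof.
case/card_gt0P => x; rewrite inE => /andP[xX yN] src kX ky; have xy := nb_clause yN.
have [b Hb nby] := minimal_unforced xy.
have [a Ha Hk] := Penc_model P kX.
pose U l := connect imp l y.
have Ub l : U l -> ~~ eval_lit b l.
  by move=> lU; apply: contra nby; apply: connect_sound.
pose c := [ffun v : V => if U (v, true) || U (v, false) then b v else a v].
have cE l : eval_lit c l = if U l || U (compl l) then eval_lit b l else eval_lit a l.
  case: l => v []; rewrite /eval_lit ffunE /compl /=; first by case: ifP.
  by rewrite orbC; case: ifP.
have kU : ~~ U k.
  apply/negP => /connectP[[|v p]] /=.
    by move=> _ E; have := nbAux xX yN; rewrite E (negPf (input_not_aux kX)).
  case/andP=> kv vp yE.
  have [z zN Ez] := clauseNb kX kv (set21 _ _).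
  have vz : v = z.
    have : v \in [set compl k; z] by rewrite -Ez set22.
    case/set2P => // vk; move: (minimal_nounit P M (compl k)).
    by move: kv; rewrite /imp vk setUid => ->.
  have v0 : 0 < #|inputs phi X v| by apply/card_gt0P; exists k; rewrite inE kX vz.
  have vy : v = y by apply: src => //; apply/connectP; exists p.
  by case/negP: ky; rewrite inE kX -vy vz.
exists c; split; last first.
- by rewrite cE /U connect0.
- rewrite cE (negPf kU) /=; case: ifP => // /Ub; by rewrite eval_compl negbK.
apply/eval_cnfP => C CP.
have /eval_cnfP/(_ C CP)[l lC el] := Ha.
have [lU|lU] := boolP (U l || U (compl l)); last by exists l; rewrite // cE (negPf lU).
case/orP: lU => lU; last first.
  by exists l => //; rewrite cE lU orbT; have := Ub _ lU; rewrite eval_compl negbK.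
(* [l] reaches [y], hence so does [compl m]; both are false in [b], and [m] satisfies the clause. *)
have [m E ml] := two_clause CP lC; exists m; first by rewrite E set21.
have mU : U (compl m).
  by apply: connect_trans lU; apply: connect1; rewrite /imp complK -E.
by rewrite cE mU orbT; have := Ub _ mU; rewrite eval_compl negbK.
Qed.

Definition turn_on a y : {ffun V -> bool} := [ffun v => if v == y.1 then y.2 else a v].

Lemma eval_turn_on a y l :
  eval_lit (turn_on a y) l = (l == y) || (l != compl y) && eval_lit a l.
Proof.
case: l y => v b [v' b']; rewrite /eval_lit ffunE /compl /= !xpair_eqE.
by case: (eqVneq v v') => _ //=; case: b; case: b'.
Qed.

Lemma turn_on_model a y : eval_cnf a phi ->
    (forall C, C \in phi -> compl y \in C -> exists2 l, l \in C :\ compl y & eval_lit a l) ->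
  eval_cnf (turn_on a y) phi.
Proof.
move=> /eval_cnfP Ha H; apply/eval_cnfP => C CP.
have [yC|yC] := boolP (compl y \in C).
  have [l /setD1P[ly lC] el] := H C CP yC.
  by exists l; rewrite // eval_turn_on ly el orbT.
have [l lC el] := Ha C CP; exists l; rewrite // eval_turn_on el andbT.
by have -> : l != compl y by [apply: contraNneq yC => <-]; rewrite orbT.
Qed.

(** Without an occurrence of [compl y], [y] can be set to true. With a single one, from [y] to [l],
    every model can be changed so that [y] and [l] agree, and they can be merged. *)
Lemma minimal_occ_compl x y : x \in X -> y \in nb phi x -> 1 < #|occ phi (compl y)|.
Proof.
move=> xX yN; have xy := nb_clause yN.
have /andP[yX cyX] := nbAux xX yN.
have turnX a g : g \in X -> eval_lit a g -> eval_lit (turn_on a y) g.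
  move=> gX Hg; rewrite eval_turn_on Hg andbT.
  by have -> : g != compl y by [apply: contraNneq cyX => <-]; rewrite orbT.
have turny a : eval_lit (turn_on a y) y by rewrite eval_turn_on eqxx.
have [C CO|O0] := pickP (mem (occ phi (compl y))); last first.
  have P' : Penc 2 (red phi [set y]) X.
    apply: (red_Penc P (subxx _)) => g gX; have [a Ha Hg] := Penc_model P gX.
    exists (turn_on a y); split; [|exact: turnX|by move=> t /set1P ->].
    apply: turn_on_model => // C CP yC.
    by have := O0 C; rewrite /= inE CP yC.
  have := minimal_card M P' erefl.
  have := @card_red _ phi [set y] [set [set compl x; y]].
  rewrite cards1 sub1set => /(_ xy) H H'.
  suff : #|red phi [set y]| + 1 <= #|phi| by rewrite addn1 ltnNge H'.
  by apply: H => C /set1P ->; rewrite disjoint_sym disjoints1 set22.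
rewrite ltnNge; apply/negP => O1; move: CO; rewrite /= inE => /andP[CP yC].
have [l El ly] := two_clause CP yC.
have yl : imp y l by rewrite /imp setUC -El.
have [|P' E' lt'] := merge_Penc P yl ly; last first.
  by have := minimal_card M P' E'; rewrite leqNgt lt'.
move=> g gX; have [a Ha Hg] := Penc_model P gX.
have [Hl|Hl] := boolP (eval_lit a l); last first.
  exists a; split=> //; rewrite (negPf Hl); apply/esym/negbTE.
  by apply: contra Hl; apply: eval_pair yl.
exists (turn_on a y); split; [|exact: turnX|by rewrite turny eval_turn_on ly Hl orbT].
apply: turn_on_model => // C' CP' yC'; exists l => //.
suff -> : C' = C by rewrite !inE ly El set21.
apply/eqP; apply: contraTT O1 => nC; rewrite -ltnNge.
have : [set C'; C] \subset occ phi (compl y).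
  by apply/subsetP => F /set2P[] ->; rewrite inE ?CP ?CP' ?yC.
by move/subset_leq_card; rewrite cards2 nC.
Qed.

(** [source_false] supplies the models for setting [y] to false. An input implying [compl y] becomes
    thin, which [source_bound_strong] exploits. *)
Lemma source_bound y : 0 < #|inputs phi X y| ->
    (forall u, 0 < #|inputs phi X u| -> connect imp u y -> u = y) ->
  exists phi', [/\ Penc 2 phi' (X :\: inputs phi X y),
    #|phi'| + 2 * #|inputs phi X y| + 2 <= #|phi|
    & forall j, j \in X -> compl y \in nb phi j -> #|occ phi' (compl j)| <= 1].
Proof.
move=> y0 src; set Y := inputs phi X y.
have sY : Y \subset X by apply/subsetP => x; rewrite inE => /andP[].
have nbY x : x \in Y -> y \in nb phi x by rewrite inE => /andP[].
have /card_gt0P[x0 x0Y] := y0.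
pose T := compl y |: [set compl x | x in Y]; exists (red phi T); split.
- apply: (red_Penc P (subsetDl _ _)) => k /setDP[kX kY].
  have [a [Ha Hk Hy]] := source_false y0 src kX kY.
  exists a; split=> // t /setU1P[->|/imsetP[x xY ->]]; rewrite eval_compl //.
  apply: Penc_false P kX (subsetP sY _ xY) _ Ha Hk.
  by apply: contraNneq kY => ->.
- have dQ : [disjoint covers phi Y & occ phi (compl y)].
    apply/pred0Pn => -[C /andP[/=]]; rewrite inE => /andP[CP /exists_inP[x xY xC]].
    rewrite inE CP /= => yC; have xX := subsetP sY _ xY.
    have [z zN E] := clauseNb xX CP xC.
    move: yC; rewrite E => /set2P[] E'.
      by have := nbAux xX (nbY _ xY); rewrite (compl_inj E') (negPf (input_not_aux xX)).
    have [a Ha Hx] := Penc_model P xX.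
    have := nb_true Ha Hx zN; rewrite -E' eval_compl.
    by rewrite (nb_true Ha Hx (nbY _ xY)).
  rewrite -addnA; apply: leq_trans (_ : #|red phi T| + #|covers phi Y :|: occ phi (compl y)| <= _).
    rewrite leq_add2l cardsU (disjoint_setI0 dQ) cards0 subn0; apply: leq_add.
      exact: (card_covers P M X3 O2 N2 sY).
    exact: minimal_occ_compl (subsetP sY _ x0Y) (nbY _ x0Y).
  apply: card_red.
    by apply/subsetP => C; rewrite !inE => /orP[]/andP[].
  move=> C; rewrite !inE => /orP[/andP[_ /exists_inP[x xY xC]]|/andP[_ yC]].
    by apply/pred0Pn; exists (compl x); rewrite /= xC in_setU1 imset_f ?orbT.
  by apply/pred0Pn; exists (compl y); rewrite /= yC setU11.
move=> j jX yj; apply: leq_trans (occ_red _ _ _) _.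
have -> : 1 = #|occ phi (compl j) :\ [set compl j; compl y]|.
  have := cardsD1 [set compl j; compl y] (occ phi (compl j)).
  by rewrite O2 // inE (nb_clause yj) set21 => -[].
apply: subset_leq_card; apply/subsetP => C; rewrite inE => /andP[CO dC].
rewrite in_setD1 CO andbT; apply: contraTneq dC => ->.
by apply/pred0Pn; exists (compl y); rewrite /= set22 setU11.
Qed.

(* A clause excluding y either belongs to the rest, which improves degree_bound,
   or touches an input, which improves source_bound. *)
Lemma source_bound_strong y : 2 < #|inputs phi X y| -> #|inputs phi X y| + 2 < #|X| ->
    (forall u, 0 < #|inputs phi X u| -> connect imp u y -> u = y) ->
  2 * #|X| + 2 * #|inputs phi X y| - 2 <= #|phi| \/
  exists phi', Penc 2 phi' (X :\: inputs phi X y) /\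
    #|phi'| + 2 * #|inputs phi X y| + 3 <= #|phi|.
Proof.
move=> y3 dX src; have y0 : 0 < #|inputs phi X y| by apply: leq_trans y3.
have /card_gt0P[x] := y0; rewrite inE => /andP[xX yN].
have /card_gt0P[C] : 0 < #|occ phi (compl y)| by apply: ltnW (minimal_occ_compl xX yN).
rewrite inE => /andP[CP yC].
have [CR|] := boolP (C \in rest phi X).
  left; have [l El ly] := two_clause CP yC.
  have := @degree_bound _ _ _ _ P M X3 O2 N2 y l [set C] y3.
  rewrite cards1 => H; have : 2 * #|X| + 2 * #|inputs phi X y| - 3 + 1 <= #|phi|.
    apply: H => [a Ha|D /set1P->]; last by rewrite CR El set21.
    by apply: eval_pair Ha _; rewrite setUC -El.
  lia.
rewrite in_setD CP andbT negbK inE CP => /exists_inP[j jX jC]; right.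
have [z zN E] := clauseNb jX CP jC.
have yj : compl y \in nb phi j.
  move: yC; rewrite E => /set2P[E'|->//].
  by have := nbAux xX yN; rewrite (compl_inj E') (negPf (input_not_aux jX)).
have [phi' [P' le' oc]] := source_bound y0 src.
have jY : j \in X :\: inputs phi X y.
  rewrite in_setD jX andbT inE jX /=; apply/negP => yj'.
  have [a Ha Hj] := Penc_model P jX.
  by have := nb_true Ha Hj yj; rewrite eval_compl (nb_true Ha Hj yj').
have sY : inputs phi X y \subset X by apply/subsetP => u; rewrite inE => /andP[].
have cX : 2 < #|X :\: inputs phi X y|.
  by rewrite cardsD (setIidPr sY); lia.
have [phi2 [P2 lt2 _]] := thin_step P' cX jY (oc j jX yj).
exists phi2; split=> //; apply: leq_trans le'.
by rewrite addn3 addn2 !ltnS -addSn leq_add2r.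
Qed.

End TwoCNF.

(* 2n + 2 sqrt n - 3 <= s *)
Definition two_cnf_size_bound n s := (2 * n <= s + 3) && (4 * n <= (s + 3 - 2 * n) ^ 2).

Lemma two_cnf_size_bound_leq n s s' : s <= s' -> two_cnf_size_bound n s -> two_cnf_size_bound n s'.
Proof.
rewrite /two_cnf_size_bound => le /andP[le1 le2].
rewrite (leq_trans le1) ?leq_add2r //= (leq_trans le2) // leq_exp2r //.
by rewrite leq_sub2r // leq_add2r.
Qed.

Lemma two_cnf_size_bound_step n s s' : 9 <= n -> (if n.-1 <= 8 then size_bound n.-1 s
    else two_cnf_size_bound n.-1 s) ->
  s + 3 <= s' -> two_cnf_size_bound n s'.
Proof.
move=> n9 gs le; apply: two_cnf_size_bound_leq le _; move: gs; rewrite /size_bound /two_cnf_size_bound.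
(* For [n = 9] the linear bound 18 for eight inputs gives 21 clauses, which is tight:
   [6 ^ 2 = 4 * 9]. *)
have [n8|n8] := leqP n.-1 8; first by have -> : n = 9; [lia | move=> /= ?; nia].
case/andP=> le1 le2; apply/andP; split; first lia.
have -> : s + 3 + 3 - 2 * n = (s + 3 - 2 * n.-1).+1 by lia.
move: (s + 3 - 2 * n.-1) le2 => r; nia.
Qed.

(** The excess [r] grows by two, and [(r + 2) ^ 2 >= 4 * n] holds once [d <= r + 1], which
    [d ^ 2 < n] provides. For [n = 10], [d = 3] the linear bound 15 for seven inputs gives only 23
    clauses, one too few. *)
Lemma two_cnf_size_bound_source n d s s' : 9 <= n -> 0 < d -> d ^ 2 < n -> (n, d) <> (10, 3) ->
  (if n - d <= 8 then size_bound (n - d) s else two_cnf_size_bound (n - d) s) ->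
  s + 2 * d + 2 <= s' -> two_cnf_size_bound n s'.
Proof.
move=> n9 d0 dn nd gs le; apply: two_cnf_size_bound_leq le _; move: gs; rewrite /size_bound /two_cnf_size_bound.
have dn' : d < n by nia.
have [n8|n8] := leqP (n - d) 8.
  have d3 : d <= 3 by nia.
  have : [|| (n == 9) && (d == 1), (n == 9) && (d == 2), (n == 10) && (d == 2)
    | (n == 11) && (d == 3)].
    have : ~~ ((n == 10) && (d == 3)).
      by apply/negP => /andP[/eqP En /eqP Ed]; apply: nd; rewrite En Ed.
    lia.
  by case/or4P => /andP[/eqP-> /eqP->] /= ?; nia.
case/andP=> le1 le2; apply/andP; split; first lia.
have -> : s + 2 * d + 2 + 3 - 2 * n = (s + 3 - 2 * (n - d)) + 2 by lia.
move: (s + 3 - 2 * (n - d)) le2 => r le2.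
have le3 : d <= r + 1 by nia.
nia.
Qed.

Lemma two_cnf_bound (V : finType) (phi : {set {set lit V}}) X :
  Penc 2 phi X -> 9 <= #|X| -> two_cnf_size_bound #|X| #|phi|.
Proof.
have [n] := ubnP #|X|; elim: n => // n IH in phi X *; rewrite ltnS => le_n P X9.
have IH' (phi' : {set {set lit V}}) X' : Penc 2 phi' X' -> 2 < #|X'| -> #|X'| < n ->
    if #|X'| <= 8 then size_bound #|X'| #|phi'| else two_cnf_size_bound #|X'| #|phi'|.
  move=> P' X3' lt'; have [X8|X8] := leqP #|X'| 8; first exact: general_bound P' _.
  exact: IH.
have [phi1 [X1 [P1 E1 M1 /two_cnf_size_bound_leq]]] := ex_minimal P; apply; rewrite -E1 in le_n X9 *.
have X4 : 3 < #|X1| by apply: leq_trans X9.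
have X3 : 2 < #|X1| by apply: leq_trans X9.
case: (regular_or_smaller P1 M1 X4) => [reg|[phi2 [X2 [P2 E2 le2]]]]; last first.
  by apply: two_cnf_size_bound_step le2 => //; rewrite -E2; apply: (IH' _ _ P2); rewrite E2; lia.
have [y y0 src] := exists_source P1 M1 X3 reg.
have sY : inputs phi1 X1 y \subset X1 by apply/subsetP => u; rewrite inE => /andP[].
have cY : #|X1 :\: inputs phi1 X1 y| = #|X1| - #|inputs phi1 X1 y|.
  by rewrite cardsD (setIidPr sY).
(* If the degree [d] of the source satisfies [d ^ 2 >= n], then [degree_bound] gives excess [2 * d]
   and suffices; otherwise the inputs implying the source are removed. *)
have [dn|dn] := leqP #|X1| (#|inputs phi1 X1 y| ^ 2).
  have d3 : 2 < #|inputs phi1 X1 y| by move: (#|inputs _ _ _|) (#|X1|) X9 dn => d m; nia.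
  have := @degree_bound _ _ _ _ P1 M1 X3 reg.1 reg.2 y y set0 d3.
  rewrite cards0 addn0 => H; have {}H : 2 * #|X1| + 2 * #|inputs phi1 X1 y| - 3 <= #|phi1|.
    by apply: H => // C; rewrite inE.
  move: (#|inputs _ _ _|) (#|X1|) (#|phi1|) X9 dn d3 H => d m s m9 dn d3 H.
  rewrite /two_cnf_size_bound; apply/andP; split; first lia.
  have : 2 * d <= s + 3 - 2 * m by lia.
  move: (s + 3 - 2 * m) => r; nia.
(* In the exceptional case both alternatives of [source_bound_strong] give 24 clauses. *)
have [nd|nd] := pselect ((#|X1|, #|inputs phi1 X1 y|) = (10, 3)).
  case: nd => E10 E3.
  have d3 : 2 < #|inputs phi1 X1 y| by rewrite E3.
  have dX : #|inputs phi1 X1 y| + 2 < #|X1| by rewrite E3 E10.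
  have [H|[phi2 [P2 le2]]] := source_bound_strong P1 M1 X3 reg d3 dX src.
    by move: H; rewrite E3 E10 /two_cnf_size_bound; move: (#|phi1|) => s ?; nia.
  have := general_bound P2; rewrite cY E3 E10 /size_bound /= => /(_ isT).
  by move: le2; rewrite E3 /two_cnf_size_bound; move: (#|phi1|) (#|phi2|) => s s2 ? ?; nia.
have [phi2 [P2 le2 _]] := source_bound P1 M1 X3 reg y0 src.
have := IH' _ _ P2; rewrite cY.
move: (#|inputs _ _ _|) (#|X1|) (#|phi1|) (#|phi2|) X9 y0 dn nd le_n le2 => d m s s2.
move=> m9 d0 dn nd le_n le2 H.
by apply: two_cnf_size_bound_source le2 => //; apply: H; nia.
Qed.


(** * Literal propagation versus unit resolution *)

Section UnitDerives.
Variable V : finType.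
Implicit Types (phi : {set {set lit V}}) (C D : {set lit V}) (g k l : lit V).

Lemma assume1 phi g C : (C \in assume phi [:: g]) = (C \in phi) || (C == [set g]).
Proof.
rewrite inE; congr (_ || _); apply/imsetP/eqP => [[h]|->]; last by exists g; rewrite ?inE.
by rewrite inE => /eqP-> ->.
Qed.

Lemma satisfiable_assume phi g :
  satisfiable (assume phi [:: g]) <-> exists2 a, eval_cnf a phi & eval_lit a g.
Proof.
split=> [[a /eval_cnfP Ha]|[a /eval_cnfP Ha Hg]]; exists a.
- by apply/eval_cnfP => C CP; apply: Ha; rewrite assume1 CP.
- by have [|l /set1P->] := Ha [set g]; rewrite // assume1 eqxx orbT.
- apply/eval_cnfP => C; rewrite assume1 => /orP[/Ha//|/eqP->].
  by exists g; rewrite ?set11.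
Qed.

(** Unit resolution only strips literals: a derived clause contains all literals of some initial
    clause that propagation does not refute. The induction keeps the witness of the parent that is
    resolved with a unit. *)
Lemma up_of_derives phi g D : is_cnf phi -> unit_derives (assume phi [:: g]) D ->
  exists C, [/\ (C \in phi) || (C == [set g]), D \subset C
    & forall k, k \in C -> k \notin D -> up phi g (compl k)].
Proof.
move=> /forall_inP cnf; elim=> {D}[C|C1 C2 l _ [D1 [P1 s1 H1]] _ [D2 [P2 s2 H2]] r12 u12].
  by rewrite assume1 => CP; exists C; split=> // k ->.
have clD D : (D \in phi) || (D == [set g]) -> is_clause D.
  case/orP=> [/cnf//|/eqP->]; apply/is_clauseP => k /set1P->.
  by rewrite inE compl_neq.
have unit D m : (D \in phi) || (D == [set g]) -> m \in D ->
    (forall k, k \in D -> k \notin [set m] -> up phi g (compl k)) -> up phi g m.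
  case/orP=> [DP mD H|/eqP-> /set1P-> _]; last exact: up_start.
  by apply: up_step DP mD _ => k kD km; apply: H; rewrite // inE.
have : l \in [set k in C1 | compl k \in C2] by rewrite r12 set11.
rewrite inE => /andP[l1 l2].
case/orP: u12 => /cards1P[m E].
  have {m}E : C1 = [set l] by move: l1; rewrite E => /set1P->.
  exists D2; split=> //.
    rewrite /resolvent; apply/subsetP => k; rewrite !inE E !inE.
    case/andP=> /norP[/negPf-> _] /=; exact: (subsetP s2).
  move=> k kD; have [k2|k2] := boolP (k \in C2); last by move=> _; apply: H2.
  rewrite /resolvent !inE k2 orbT andbT negbK => /orP[]/eqP Ek; last first.
    by rewrite Ek complK; apply: (unit D1) => //; [apply: (subsetP s1) | rewrite -E].
  by have /is_clauseP/(_ _ (subsetP s2 _ l2)) := clD _ P2; rewrite complK -Ek kD.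
have {m}E : C2 = [set compl l] by move: l2; rewrite E => /set1P->.
exists D1; split=> //.
  rewrite /resolvent; apply/subsetP => k; rewrite !inE E !inE.
  case/andP=> /norP[_ /negPf->]; rewrite orbF; exact: (subsetP s1).
move=> k kD; have [k1|k1] := boolP (k \in C1); last by move=> _; apply: H1.
rewrite /resolvent !inE k1 andbT negbK => /orP[]/eqP Ek.
  by rewrite Ek; apply: (unit D2) => //; [apply: (subsetP s2) | rewrite -E].
by have /is_clauseP/(_ _ (subsetP s1 _ l1)) := clD _ P1; rewrite -Ek kD.
Qed.

Lemma unit_derives_up phi g l : is_cnf phi ->
  unit_derives (assume phi [:: g]) [set l] <-> up phi g l.
Proof.
move=> cnf; split=> [/(up_of_derives cnf)[C [/orP[CP|/eqP->] + H]]|].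
- rewrite sub1set => lC; apply: up_step CP lC _ => k kC kl.
  by apply: H; rewrite // inE.
- by rewrite sub1set => /set1P->; apply: up_start.
elim=> {l}[|C l CP lC _ IH].
  by apply: UnitDerivesIn; rewrite assume1 eqxx orbT.
have cl := forall_inP cnf C CP.
(* The literals of [C] other than [l] are resolved away one at a time; [D] is the current
   remainder. *)
suff H D : l \in D -> D \subset C -> unit_derives (assume phi [:: g]) D ->
    unit_derives (assume phi [:: g]) [set l].
  by apply: (H C) => //; apply: UnitDerivesIn; rewrite assume1 CP.
have [m] := ubnP #|D|; elim: m => // m IHm in D *; rewrite ltnS => le lD sD uD.
have [E|[k /setD1P[kl kD]]] := set_0Vmem (D :\ l).
  by rewrite -(setD1K lD) E setU0 in uD.
have kC := subsetP sD _ kD.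
have ckC : compl k \notin D.
  by apply: contra (is_clauseP _ cl k kC); apply: (subsetP sD).
apply: (IHm (D :\ k)).
- by rewrite (cardsD1 k) kD in le.
- by rewrite !inE eq_sym kl.
- exact: subset_trans (subsetDl _ _) sD.
have -> : D :\ k = resolvent k D [set compl k].
  apply/setP => j; rewrite !inE negb_or; case: (eqVneq j k) => //= _.
  by case: (eqVneq j (compl k)) => [->|] /=; rewrite ?(negPf ckC) ?orbF.
apply: UnitDerivesRes uD (IH k kC kl) _ _; last by rewrite cards1 orbT.
apply/setP => j; rewrite !inE (inj_eq (@compl_inj _)).
by case: eqVneq => [->|]; rewrite ?kD ?andbF.
Qed.

(** This discards the contradiction alternative in [PC_encoding]. *)
Lemma not_derives_set0 phi g : is_cnf phi -> satisfiable (assume phi [:: g]) ->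
  ~ unit_derives (assume phi [:: g]) set0.
Proof.
move=> cnf /satisfiable_assume[a Ha Hg] /(up_of_derives cnf)[C [CP _ H]].
have [l lC el] : exists2 l, l \in C & eval_lit a l.
  case/orP: CP => [CP|/eqP->]; last by exists g; rewrite ?set11.
  by have /eval_cnfP/(_ C CP) := Ha.
have := up_sound Ha Hg (H l lC _); rewrite eval_compl el inE.
by move/(_ isT).
Qed.

End UnitDerives.

(** * P-encodings versus encodings of AMO and EO *)

Section Encodings.
Variables n l : nat.
Local Notation var := ('I_n + 'I_l)%type.
Implicit Types (phi : {set {set lit var}}) (i j : 'I_n).

Definition xlit i : lit var := input_lit l (pos i).

Lemma eval_xlit a i : eval_lit a (xlit i) = a (inl i).
Proof. by rewrite /eval_lit /= eqb_id. Qed.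

Lemma xlit_inj : injective xlit.
Proof. by move=> i j []. Qed.

Lemma P_encodingP phi : P_encoding phi <->
  [/\ 0 < n, is_cnf phi, forall i, exists2 a, eval_cnf a phi & a (inl i)
    & forall i j, i != j -> up phi (xlit i) (compl (xlit j))].
Proof.
split=> -[n0 cnf H1 H2]; split=> // i.
- have /satisfiable_assume[a Ha Hi] := H1 i.
  by exists a; rewrite // -eval_xlit.
- by move=> j /H2/(unit_derives_up _ _ cnf).
- apply/satisfiable_assume; have [a Ha Hi] := H1 i.
  by exists a; rewrite // -/(xlit i) eval_xlit.
- by move=> j /H2 H; apply/(unit_derives_up _ _ cnf).
Qed.

Lemma P_encoding_Penc w phi : P_encoding phi -> (forall C, C \in phi -> #|C| <= w) ->
  Penc w phi [set xlit i | i : 'I_n].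
Proof.
move=> /P_encodingP[n0 cnf H1 H2] W; split=> //.
  by move=> _ /imsetP[i _ ->]; have [a Ha Hi] := H1 i; exists a; rewrite ?eval_xlit.
move=> _ _ /imsetP[i _ ->] /imsetP[j _ ->] ij; apply: H2.
by apply: contraNneq ij => ->.
Qed.

Lemma P_encoding_size_bound phi : P_encoding phi -> 2 < n -> size_bound n #|phi|.
Proof.
move=> Pphi n3; have cX : #|[set xlit i | i : 'I_n]| = n.
  by rewrite card_imset ?card_ord //; apply: xlit_inj.
(* Clauses are sets of literals, so this width is no restriction. *)
rewrite -{1}cX; apply: (@general_bound _ #|lit var|); last by rewrite cX.
by apply: P_encoding_Penc => // C _; apply: max_card.
Qed.

Lemma P_encoding_two_cnf_size_bound phi : P_encoding phi -> is_2cnf phi -> 8 < n -> two_cnf_size_bound n #|phi|.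
Proof.
move=> Pphi /andP[_ /forall_inP W] n9; have cX : #|[set xlit i | i : 'I_n]| = n.
  by rewrite card_imset ?card_ord //; apply: xlit_inj.
rewrite -{1}cX; apply: two_cnf_bound; last by rewrite cX.
exact: P_encoding_Penc.
Qed.

Definition unit_vec i : {ffun 'I_n -> bool} := [ffun j => j == i].

Lemma unit_vec_set i : [set j | unit_vec i j] = [set i].
Proof. by apply/setP => j; rewrite !inE ffunE. Qed.

Lemma AMOP (a : {ffun 'I_n -> bool}) :
  reflect (forall i j, a i -> a j -> i = j) (AMO a).
Proof.
apply: (iffP card_le1_eqP) => H i j; first by move=> ai aj; apply: H; rewrite inE.
by rewrite !inE => ai aj; rewrite (H i j ai aj).
Qed.

Lemma join_parts (c : {ffun var -> bool}) :
  c = join [ffun i => c (inl i)] [ffun j => c (inr j)].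
Proof. by apply/ffunP => -[i|j]; rewrite !ffunE. Qed.

(** The hypotheses place [f] between EO and AMO, which treats both at once. *)
Lemma PC_encoding_P (f : boolfun n) phi : 0 < n ->
    (forall i, f (unit_vec i)) -> (forall a, f a -> AMO a) ->
  PC_encoding f phi -> P_encoding phi.
Proof.
move=> n0 f1 fA [[cnf enc] pc].
have sat i : satisfiable (assume phi [:: xlit i]).
  apply/satisfiable_assume; have /enc[b Hb] := f1 i.
  by exists (join (unit_vec i) b); rewrite // eval_xlit !ffunE eqxx.
split=> // i j ij; case: (pc [:: pos i] (neg j)) => //.
  move=> a /fA/AMOP H /= /andP[+ _]; rewrite /eval_lit /= eqb_id => ai.
  by apply/eqP/negP => aj; rewrite (H i j ai aj) eqxx in ij.
by move/(not_derives_set0 cnf (sat i)).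
Qed.

(* The literals propagated from x_i can be forced onto any model of a 2-CNF
   formula, so propagation from x_i misses no consequence. *)
Lemma two_cnf_encoding_P phi : 0 < n -> encoding (@AMO n) phi -> is_2cnf phi ->
  P_encoding phi.
Proof.
move=> n0 [cnf enc] /andP[_ /forall_inP W].
have mod i : exists2 a, eval_cnf a phi & a (inl i).
  have /enc[b Hb] : AMO (unit_vec i) by rewrite /AMO unit_vec_set cards1.
  by exists (join (unit_vec i) b); rewrite // !ffunE eqxx.
apply/P_encodingP; split=> // i j ij.
have [//|nup] := pselect (up phi (xlit i) (compl (xlit j))).
have [a Ha aj] := mod j; have [b Hb bi] := mod i; rewrite -eval_xlit in bi.
have cons k : up phi (xlit i) k -> ~ up phi (xlit i) (compl k).
  by move=> /(up_sound Hb bi) + /(up_sound Hb bi); rewrite eval_compl => ->.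
(* [c] makes the propagated literals true and follows the model [a] of [x_j] elsewhere. Were
   [compl (xlit j)] not propagated, [c] would satisfy both [x_i] and [x_j]. *)
pose c := [ffun v : var => if `[< up phi (xlit i) (v, true) >] then true
  else if `[< up phi (xlit i) (v, false) >] then false else a v].
have cup k : up phi (xlit i) k -> eval_lit c k.
  case: k => v [] H; rewrite /eval_lit ffunE /=; first by rewrite asboolT.
  by rewrite asboolF ?asboolT // => H'; apply: (cons (v, true) H').
have ca k : ~ up phi (xlit i) (compl k) -> eval_lit a k -> eval_lit c k.
  case: k => v [] /= H; rewrite /eval_lit ffunE /=; first by case: ifP => // _; rewrite asboolF.
  by rewrite asboolF //; case: ifP.
have Hc : eval_cnf c phi.
  apply/eval_cnfP => C CP; have /eval_cnfP/(_ C CP)[k kC ek] := Ha.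
  have [uk|uk] := pselect (up phi (xlit i) (compl k)); last by exists k; rewrite ?ca.
  have [E|[m /setD1P[mk mC]]] := set_0Vmem (C :\ k).
    case: (cons k) => //; apply: up_step CP kC _ => m mC mk.
    by have := in_set0 m; rewrite -E !inE mk mC.
  exists m => //; apply: cup; apply: (up_step CP mC) => p pC pm.
  have [->//|pk] := eqVneq p k.
  have := W C CP; rewrite (cardsD1 k) kC (cardsD1 m) (cardsD1 p) !inE.
  by rewrite mk mC pm pk pC.
have /AMOP/(_ i j) : AMO [ffun i => c (inl i)].
  by apply/enc; exists [ffun j => c (inr j)]; rewrite -join_parts.
have ci : c (inl i) by rewrite -eval_xlit; apply/cup/up_start.
have cj : c (inl j) by rewrite -eval_xlit; apply: ca; rewrite ?eval_xlit.
by rewrite [_ i]ffunE [_ j]ffunE => /(_ ci cj) E; rewrite E eqxx in ij.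
Qed.

(* 2-CNF formulas are closed under the majority of three models; the majority of
   models of x_0, x_1 and x_2 sets all inputs to 0. *)
Lemma P_two_cnf_encoding phi : 2 < n -> P_encoding phi -> is_2cnf phi ->
  encoding (@AMO n) phi.
Proof.
move=> n3 /P_encodingP[n0 cnf H1 H2] /andP[_ /forall_inP W]; split=> // a.
have excl c i j : eval_cnf c phi -> c (inl i) -> c (inl j) -> i = j.
  move=> Hc; rewrite -!eval_xlit => ci cj; apply/eqP; apply: contraT => /H2.
  by move/(up_sound Hc ci); rewrite eval_compl cj.
split=> [/AMOP amo|[b Hb]]; last first.
  by apply/AMOP => i j ai aj; apply: excl Hb _ _; rewrite ffunE.
have ext c : eval_cnf c phi -> (forall i, c (inl i) = a i) ->
    exists b, eval_cnf (join a b) phi.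
  move=> Hc ca; exists [ffun j => c (inr j)].
  suff -> : a = [ffun i => c (inl i)] by rewrite -join_parts.
  by apply/ffunP => i; rewrite ffunE ca.
have [i ai|a0] := pickP a.
  have [c Hc ci] := H1 i; apply: (ext c Hc) => j.
  by apply/idP/idP => [/(excl _ _ _ Hc ci) <-//|/(amo _ _ ai) <-].
pose i0 := Ordinal n0; pose i1 := Ordinal (ltnW n3); pose i2 := Ordinal n3.
have [c0 M0 v0] := H1 i0; have [c1 M1 v1] := H1 i1; have [c2 M2 v2] := H1 i2.
pose c := [ffun v => [|| c0 v && c1 v, c0 v && c2 v | c1 v && c2 v]].
have cE k : eval_lit c k = [|| eval_lit c0 k && eval_lit c1 k,
    eval_lit c0 k && eval_lit c2 k | eval_lit c1 k && eval_lit c2 k].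
  case: k => v b; rewrite /eval_lit ffunE /=.
  by case: (c0 v); case: (c1 v); case: (c2 v); case: b.
apply: (ext c) => [|j]; last first.
  rewrite a0 ffunE; apply/negbTE/negP => /or3P[]/andP[h h'].
  - by have := excl _ _ _ M0 v0 h; rewrite -(excl _ _ _ M1 v1 h').
  - by have := excl _ _ _ M0 v0 h; rewrite -(excl _ _ _ M2 v2 h').
  - by have := excl _ _ _ M1 v1 h; rewrite -(excl _ _ _ M2 v2 h').
apply/eval_cnfP => C CP.
have /eval_cnfP/(_ C CP)[k0 k0C e0] := M0.
have /eval_cnfP/(_ C CP)[k1 k1C e1] := M1.
have /eval_cnfP/(_ C CP)[k2 k2C e2] := M2.
(* A clause with at most two literals cannot hold three distinct witnesses, so one literal is true
   in two of the models. *)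
have [E|n01] := eqVneq k0 k1; first by exists k0; rewrite // cE e0 E e1.
have [E|n02] := eqVneq k0 k2; first by exists k0; rewrite // cE e0 E e2 !orbT.
have [E|n12] := eqVneq k1 k2; first by exists k1; rewrite // cE e1 E e2 !orbT.
have := W C CP; rewrite (cardsD1 k0) k0C (cardsD1 k1) (cardsD1 k2) !inE.
by rewrite k1C k2C eq_sym n01 eq_sym n12 eq_sym n02.
Qed.

End Encodings.

(** A common satisfying assignment certifies that two literals are not complementary. *)
Lemma pair_clause (V : finType) (a : {ffun V -> bool}) (k l : lit V) :
  eval_lit a k -> eval_lit a l -> is_clause [set k; l].
Proof.
move=> ek el; have e m : m \in [set k; l] -> eval_lit a m by case/set2P=> ->.
by apply/is_clauseP => m /e em; apply/negP => /e; rewrite eval_compl em.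
Qed.

(** * A 2-CNF P-encoding with [3n - 6] clauses *)

Section Ladder.
Variable m : nat.
Hypothesis m0 : 0 < m.
Local Notation var := ('I_m.+2 + 'I_m.+1)%type.

Definition xl j : lit var := (inl (inord j), true).

(* "One of x_0, ..., x_j is true"; both ends of the chain are input literals. *)
Definition pre j : lit var :=
  if j == 0 then xl 0 else if j == m then compl (xl m.+1) else (inr (inord j), true).

(** A sequential counter on [n = m + 2] inputs: [m] links of three clauses each. *)
Definition ladder : {set {set lit var}} :=
  [set C in [seq [set compl (pre j); pre j.+1] | j <- iota 0 m]
         ++ [seq [set compl (xl j.+1); pre j.+1] | j <- iota 0 m]
         ++ [seq [set compl (pre j); compl (xl j.+1)] | j <- iota 0 m]].

Lemma ladderP C : reflect
  (exists2 j, j < m & [\/ C = [set compl (pre j); pre j.+1],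
     C = [set compl (xl j.+1); pre j.+1] | C = [set compl (pre j); compl (xl j.+1)]])
  (C \in ladder).
Proof.
rewrite inE !mem_cat; apply: (iffP or3P) => [[]/mapP[j]|[j jm []->]].
- by rewrite mem_iota => ? ->; exists j => //; constructor 1.
- by rewrite mem_iota => ? ->; exists j => //; constructor 2.
- by rewrite mem_iota => ? ->; exists j => //; constructor 3.
- by constructor 1; apply/mapP; exists j; rewrite ?mem_iota.
- by constructor 2; apply/mapP; exists j; rewrite ?mem_iota.
- by constructor 3; apply/mapP; exists j; rewrite ?mem_iota.
Qed.

Lemma card_ladder : #|ladder| <= 3 * m.
Proof.
rewrite cardsE; apply: leq_trans (card_size _) _.
by rewrite !size_cat !size_map size_iota; lia.
Qed.

Definition ladder_model (i : nat) : {ffun var -> bool} :=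
  [ffun v : var => match v with inl k => k == i :> nat | inr k => i <= k end].

Lemma eval_xl i j : j <= m.+1 -> eval_lit (ladder_model i) (xl j) = (j == i).
Proof. by move=> jm; rewrite /eval_lit ffunE /= inordK // eqb_id. Qed.

Lemma eval_pre i j : i <= m.+1 -> j <= m -> eval_lit (ladder_model i) (pre j) = (i <= j).
Proof.
move=> im jm; rewrite /pre; case: eqP => [->|_]; first by rewrite eval_xl // leqn0 eq_sym.
case: eqP => [->|_]; last by rewrite /eval_lit ffunE /= inordK // eqb_id.
by rewrite eval_compl eval_xl // eq_sym -ltnS ltn_neqAle im andbT.
Qed.

Lemma ladder_2cnf : is_2cnf ladder.
Proof.
apply/andP; split; apply/forall_inP => C /ladderP[j jm H]; last first.
  by case: H => ->; rewrite cards2; case: (_ != _).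
case: H => ->.
- apply: (@pair_clause _ (ladder_model j.+1)); rewrite ?eval_compl ?eval_pre; lia.
- apply: (@pair_clause _ (ladder_model j)); rewrite ?eval_compl ?eval_xl ?eval_pre; lia.
- apply: (@pair_clause _ (ladder_model j.+2)); rewrite ?eval_compl ?eval_xl ?eval_pre; lia.
Qed.

Lemma ladder_P : P_encoding ladder.
Proof.
have xlE (i : 'I_m.+2) : xlit m.+1 i = xl i by rewrite /xl inord_val.
apply/P_encodingP; split=> //; first by case/andP: ladder_2cnf.
  move=> i; exists (ladder_model i); last by rewrite ffunE.
  have im : i <= m.+1 by rewrite -ltnS.
  apply/eval_cnfP => C /ladderP[j jm H].
  have [le|lt] := leqP i j.
    case: H => ->.
    - by exists (pre j.+1); rewrite ?set22 // eval_pre //; lia.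
    - by exists (pre j.+1); rewrite ?set22 // eval_pre //; lia.
    - by exists (compl (xl j.+1)); rewrite ?set22 // eval_compl eval_xl //; lia.
  case: H => ->.
  - by exists (compl (pre j)); rewrite ?set21 // eval_compl eval_pre //; lia.
  - have [E|ne] := eqVneq (nat_of_ord i) j.+1.
      by exists (pre j.+1); rewrite ?set22 // eval_pre //; lia.
    by exists (compl (xl j.+1)); rewrite ?set21 // eval_compl eval_xl //; lia.
  - by exists (compl (pre j)); rewrite ?set21 // eval_compl eval_pre //; lia.
move=> i k ik; rewrite !xlE.
have im : i <= m.+1 by rewrite -ltnS.
have km : k <= m.+1 by rewrite -ltnS.
have {ik} : nat_of_ord i != k by [].
move: (nat_of_ord i) (nat_of_ord k) im km => {}i {}k im km ik.
pose U := up ladder (xl i).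
have c1 j : j < m -> [set compl (pre j); pre j.+1] \in ladder.
  by move=> jm; apply/ladderP; exists j => //; constructor 1.
have c2 j : j < m -> [set compl (xl j.+1); pre j.+1] \in ladder.
  by move=> jm; apply/ladderP; exists j => //; constructor 2.
have c3 j : j < m -> [set compl (pre j); compl (xl j.+1)] \in ladder.
  by move=> jm; apply/ladderP; exists j => //; constructor 3.
have up_contra u v : [set compl u; v] \in ladder -> U (compl v) -> U (compl u).
  by move=> H; apply: up_bin; rewrite complK setUC.
have pm : pre m = compl (xl m.+1) by rewrite /pre eqxx (negPf (lt0n_neq0 m0)).
(* For [k > i] propagation climbs the chain from [pre i]; for [k < i] it descends from the negation
   of [pre (i - 1)]. *)
have [lt|gt] := ltnP i k.
  have up_pre j : i <= j -> j <= m -> U (pre j).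
    elim: j => [|j IH] ij jm.
      by have i0 : i = 0 by [lia]; rewrite /U i0; apply: up_start.
    have [E|ne] := eqVneq i j.+1; last by apply: up_bin (c1 j jm) _; apply: IH; lia.
    by apply: up_bin (c2 j jm) _; rewrite -E; apply: up_start.
  have [E|ne] := eqVneq k m.+1.
    by rewrite E -pm; apply: up_pre; lia.
  have -> : k = k.-1.+1 by lia.
  by apply: up_bin (c3 _ _) _; [lia | apply: up_pre; lia].
have lt : k < i by lia.
have dn_pre d : d < i -> U (compl (pre (i.-1 - d))).
  elim: d => [|d IH] di.
    rewrite subn0; have [E|ne] := eqVneq i m.+1.
      by rewrite /U E /= pm complK; apply: up_start.
    apply: up_contra (c3 _ _) _; first lia.
    by rewrite complK prednK; [apply: up_start | lia].
  apply: up_contra (c1 _ _) _; first lia.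
  have -> : (i.-1 - d.+1).+1 = i.-1 - d by lia.
  by apply: IH; lia.
have := dn_pre (i.-1 - k); have -> : i.-1 - (i.-1 - k) = k by lia.
have -> : i.-1 - k < i by lia.
move=> /(_ isT); case: k lt {km gt ik} => [|k] lt; first by rewrite /pre eqxx.
by apply: up_contra; apply: c2; lia.
Qed.

End Ladder.


(** * One and two inputs, existence of minima, and assembly of the theorem *)

Lemma encoding_AMO1 : encoding (@AMO 1) (set0 : {set {set lit ('I_1 + 'I_0)%type}}).
Proof.
split; first by apply/forall_inP => C; rewrite inE.
move=> a; split=> _; last by apply/AMOP => i j; rewrite !ord1.
by exists [ffun=> true]; apply/eval_cnfP => C; rewrite inE.
Qed.

Definition AMO2_clause : {set lit ('I_2 + 'I_0)%type} :=
  [set compl (xlit 0 ord0); compl (xlit 0 ord_max)].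

Lemma AMO2_is_clause : is_clause AMO2_clause.
Proof.
by apply: (@pair_clause _ [ffun=> false]); rewrite eval_compl eval_xlit ffunE.
Qed.

Lemma encoding_AMO2 : encoding (@AMO 2) [set AMO2_clause].
Proof.
split; first by apply/forall_inP => C /set1P ->; apply: AMO2_is_clause.
have evalE (a : {ffun 'I_2 -> bool}) (b : {ffun 'I_0 -> bool}) :
    eval_cnf (join a b) [set AMO2_clause] = ~~ (a ord0 && a ord_max).
  have e k : eval_lit (join a b) (compl (xlit 0 k)) = ~~ a k.
    by rewrite eval_compl eval_xlit ffunE.
  apply/eval_cnfP/idP => [/(_ _ (set11 _))[k /set2P[]->]|H C /set1P->].
  - by rewrite e negb_and => ->.
  - by rewrite e negb_and orbC => ->.
  have : ~~ a ord0 || ~~ a ord_max by rewrite -negb_and.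
  by case/orP => H'; [exists (compl (xlit 0 ord0)) | exists (compl (xlit 0 ord_max))];
     rewrite ?set21 ?set22 ?e.
move=> a; split=> [/AMOP H|[b]].
  by exists [ffun=> true]; rewrite evalE; apply/negP => /andP[h h']; have := H _ _ h h'.
rewrite evalE => H; apply/AMOP => i j ai aj; apply/eqP; apply: contraNT H => ij.
by case: i j ai aj ij => [[|[|//]] ?] [[|[|//]] ?] ai aj //= _; apply/andP; split;
  apply: etrans _ ai + apply: etrans _ aj; congr (a _); apply: val_inj.
Qed.

Lemma two_cnf_AMO1 : is_2cnf (set0 : {set {set lit ('I_1 + 'I_0)%type}}).
Proof. by apply/andP; split; apply/forall_inP => C; rewrite inE. Qed.

Lemma two_cnf_AMO2 : is_2cnf [set AMO2_clause].
Proof.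
apply/andP; split; apply/forall_inP => C /set1P ->; first exact: AMO2_is_clause.
by rewrite cards2; case: (_ != _).
Qed.

Lemma P_encoding_2cnf_exists n : 0 < n -> exists k, P_encoding_2cnf_size n k.
Proof.
case: n => [//|[|[|m]]] _.
- exists #|set0 : {set {set lit ('I_1 + 'I_0)%type}}|, 0, set0.
  split=> //; last exact: two_cnf_AMO1.
  exact: two_cnf_encoding_P _ encoding_AMO1 two_cnf_AMO1.
- exists #|[set AMO2_clause]|, 0, [set AMO2_clause].
  split=> //; last exact: two_cnf_AMO2.
  exact: two_cnf_encoding_P _ encoding_AMO2 two_cnf_AMO2.
exists #|ladder m.+1|, m.+2, (ladder m.+1).
by split=> //; [apply: ladder_P | apply: ladder_2cnf].
Qed.

Lemma exists_minimum (A : nat -> Prop) : (exists k, A k) -> exists m, minimum A m.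
Proof.
move=> [k Ak]; have ex : exists k, `[< A k >] by exists k; apply/asboolP.
case: (ex_minnP ex) => m /asboolP Am mn; exists m; split=> // j Aj.
by apply: mn; apply/asboolP.
Qed.

Lemma P_encoding_size_sub n k : P_encoding_2cnf_size n k -> P_encoding_size n k.
Proof. by move=> [l [phi [H _ E]]]; exists l, phi. Qed.

(** For one or two inputs a P-encoding may exclude the zero assignment, so explicit encodings of AMO
    attain the minimum there. *)
Lemma two_cnf_minimum n k : 0 < n -> minimum (P_encoding_2cnf_size n) k ->
  minimum (encoding_2cnf_size (@AMO n)) k.
Proof.
move=> n0 [[l [phi [Pphi two E]]] mn].
have lower j : encoding_2cnf_size (@AMO n) j -> k <= j.
  move=> [l' [phi' [enc' two' E']]]; apply: mn; exists l', phi'; split=> //.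
  exact: two_cnf_encoding_P.
split=> //; case: n => [//|[|[|m]]] in n0 phi Pphi two E mn lower *; last first.
- by exists l, phi; split=> //; apply: P_two_cnf_encoding.
- have k1 : k <= 1.
    apply: lower; exists 0, [set AMO2_clause]; rewrite cards1.
    by split=> //; [apply: encoding_AMO2 | apply: two_cnf_AMO2].
  have k0 : 0 < k.
    rewrite -E; have /P_encodingP[_ _ _ H] := Pphi.
    exact: up_gt0 (H ord0 ord_max isT) _.
  exists 0, [set AMO2_clause]; split; [exact: encoding_AMO2 | exact: two_cnf_AMO2 |].
  by rewrite cards1; lia.
exists 0, set0; split; [exact: encoding_AMO1 | exact: two_cnf_AMO1 |].
rewrite cards0; apply/esym/eqP; rewrite -leqn0; apply: lower.
exists 0, set0; rewrite cards0.
by split=> //; [apply: encoding_AMO1 | apply: two_cnf_AMO1].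
Qed.

Lemma sqrt_nat_le (R : rcfType) (n r : nat) : n <= r ^ 2 -> (Num.sqrt n%:R <= r%:R :> R)%R.
Proof.
move=> le; rewrite -[leRHS]ger0_norm ?ler0n // -sqrtr_sqr ler_sqrt ?exprn_ge0 ?ler0n //.
by rewrite -natrX ler_nat.
Qed.

Theorem theorem1 (R : rcfType) :
  exists S S2 : nat -> nat,
    (forall n : nat, 1 <= n -> minimum (P_encoding_size n) (S n)) /\
    (forall n : nat, 1 <= n -> minimum (P_encoding_2cnf_size n) (S2 n)) /\
    (forall n : nat, 1 <= n ->
       forall (l : nat) (phi : {set {set lit ('I_n + 'I_l)%type}}),
         PC_encoding (@AMO n) phi \/ PC_encoding (@EO n) phi -> S n <= #|phi|) /\
    (forall n : nat, 1 <= n ->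
       minimum (encoding_2cnf_size (@AMO n)) (S2 n)) /\
    (forall n : nat, 3 <= n <= 8 -> S n = 3 * n - 6 /\ S2 n = 3 * n - 6) /\
    (forall n : nat, 9 <= n ->
       (2 * n%:R + Num.sqrt n%:R - 2 <= (S n)%:R :> R)%R) /\
    (forall n : nat, 9 <= n ->
       (2 * n%:R + 2 * Num.sqrt n%:R - 3 <= (S2 n)%:R :> R)%R).
Proof.
(* Guarding the property by [1 <= n] lets [choice] produce total functions. *)
have exS n : exists k, 1 <= n -> minimum (P_encoding_size n) k.
  have [n0|//] := ltnP 0 n; last by exists 0.
  have [|k Hk] := @exists_minimum (P_encoding_size n); last by exists k.
  by have [k /P_encoding_size_sub Hk] := P_encoding_2cnf_exists n0; exists k.
have exS2 n : exists k, 1 <= n -> minimum (P_encoding_2cnf_size n) k.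
  have [n0|//] := ltnP 0 n; last by exists 0.
  by have [k Hk] := exists_minimum (P_encoding_2cnf_exists n0); exists k.
have [S HS] := choice exS; have [S2 HS2] := choice exS2.
have boundS n : 2 < n -> size_bound n (S n).
  by move=> n3; have [|[l [phi [/P_encoding_size_bound H <-]]] _] := HS n; [lia | apply: H].
exists S, S2; do 2!split=> //; split; [|split; [|split; [|split]]].
- move=> n n0 l phi H; have [_] := HS n n0; apply; exists l, phi; split=> //.
  have amo1 i : AMO (unit_vec i : {ffun 'I_n -> bool}) by rewrite /AMO unit_vec_set cards1.
  case: H; apply: PC_encoding_P => // [i|a /eqP]; first by rewrite /EO unit_vec_set cards1.
  by rewrite /AMO => ->.
- by move=> n n0; apply: two_cnf_minimum n0 (HS2 n n0).
- move=> n /andP[n3 n8].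
  have n0 : 1 <= n by apply: ltn_trans n3.
  have [A1 m1] := HS n n0; have [A2 m2] := HS2 n n0.
  have le1 : 3 * n - 6 <= S n by have := boundS n n3; rewrite /size_bound n8.
  have le2 : S n <= S2 n by apply: m1; apply: P_encoding_size_sub.
  (* The ladder with [n - 2] links attains the bound. *)
  have le3 : S2 n <= 3 * n - 6.
    have [m En] : exists m, n = m.+3 by exists (n - 3); lia.
    rewrite En in m2 *; apply: leq_trans (_ : #|ladder m.+1| <= _).
      by apply: m2; exists m.+2, (ladder m.+1); split=> //; [apply: ladder_P | apply: ladder_2cnf].
    by apply: leq_trans (card_ladder _) _; lia.
  lia.
- move=> n n9; have := boundS n (ltn_trans _ n9) => /(_ isT).
  rewrite /size_bound leqNgt n9 /= => /andP[le1 /(sqrt_nat_le R)].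
  rewrite natrB // natrM natrD => H; lra.
- move=> n n9; have [|[l [phi [/P_encoding_two_cnf_size_bound H /H{}H E]]] _] := HS2 n; first lia.
  have := H n9; rewrite E => /andP[le1 le2].
  have : (Num.sqrt (4 * n)%:R <= (S2 n + 3 - 2 * n)%:R :> R)%R by apply: sqrt_nat_le.
  have four : (4%:R = 2%:R ^+ 2 :> R)%R by rewrite -natrX.
  rewrite natrM sqrtrM ?ler0n // four sqrtr_sqr ger0_norm ?ler0n // natrB // natrM natrD.
  by move=> {}H; lra.
Qed.
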